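(* Let $G$ be a compact connected metric graph, and let $h(t,q)=H(t,q,q)$ be the diagonal restriction of the heat kernel $H$ of the Kirchhoff-Neumann Laplacian on $G$. For each edge $\mathbf e$, parametrized by $x\in[0,a]$, the restriction $h_{\mathbf e}(t,\cdot)$ of $h(t,\cdot)$ to $\mathbf e$ satisfies, for $t>0$, $$\bigl(\partial_t-\tfrac14\partial_x^2\bigr)\partial_xh_{\mathbf e}(t,x)=0.$$ Moreover, for each $t>0$, $h(t,\cdot)$ is a continuous function on $G$ and satisfies the Kirchhoff-Neumann conditions at the vertices, i.e., at each vertex the outward derivatives of $h(t,\cdot)$ along the incident edges sum to zero.
   Context: A compact metric graph $G$ consists of finitely many vertices and finitely many edges, each edge identified with an interval of finite positive length; loops and multiple edges are allowed (a loop contributes two outward derivatives at its vertex). The Kirchhoff-Neumann Laplacian $-\Delta$ is the self-adjoint operator on $L^2(G)$ associated to the quadratic form $\|u'\|^2$ with domain $H^1(G)$. It acts as $-d^2/dx^2$ on each edge, on functions that are continuous on $G$ and whose outward derivatives (from the vertex into the incident edge-ends) sum to zero at each vertex. $H(t,q_1,q_2)$ is the integral kernel of $e^{t\Delta}$; equivalently $H(t,q_1,q_2)=\sum_j e^{-t\lambda_j}\psi_j(q_1)\psi_j(q_2)$ for an orthonormal basis of real eigenfunctions $\psi_j$ with eigenvalues $\lambda_j$. *)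

(* Defs.v *)
From HB Require Import structures.
From mathcomp Require Import all_boot all_order all_algebra.
From mathcomp Require Import all_classical all_reals all_analysis.
Set Implicit Arguments.
Unset Strict Implicit.
Unset Printing Implicit Defensive.
Import Order.TTheory GRing.Theory Num.Theory.
Import numFieldNormedType.Exports.
Local Open Scope classical_set_scope.
Local Open Scope ring_scope.

(* Edge [e] is a copy of [0, len e] whose ends 0 and [len e] are attached to
   [src e] and [tgt e]; the orientation is only a choice of parametrization.
   Loops and multiple edges are allowed. *)
Record metric_graph (R : realType) := MetricGraph {
  vertex : finType;
  edge : finType;
  src : edge -> vertex;
  tgt : edge -> vertex;
  len : edge -> R;
  len_gt0 : forall e, 0 < len e }.

Section Points.
Variables (R : realType) (G : metric_graph R).

(* As a set, G is the disjoint union of its vertices and of its open edges. *)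
Definition is_point (p : vertex G + edge G * R) : bool :=
  match p with
  | inl _ => true
  | inr (e, x) => 0 < x < len e
  end.

Definition gpoint : Type := {p : vertex G + edge G * R | is_point p}.
HB.instance Definition _ := Choice.on gpoint.

Definition vpt (v : vertex G) : gpoint := exist _ (inl v) isT.

(* The parametrization [0, len e] -> G of the edge e, extended to R by clamping:
   it is [vpt (src e)] for x <= 0 and [vpt (tgt e)] for x >= len e. *)
Definition chart (e : edge G) (x : R) : gpoint :=
  insubd (if x <= 0 then vpt (src e) else vpt (tgt e)) (inr (e, x)).

(* The topology of G is the quotient (final) topology for the maps
   [0, len e] -> G.  Since clamping is a retraction R -> [0, len e], it is also
   the final topology for the maps [chart e : R -> G]. *)
Definition graph_open (A : set gpoint) : Prop :=
  forall e, open (chart e @^-1` A : set R).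

Let graph_openT : graph_open setT.
Proof. by move=> e; rewrite preimage_setT; exact: openT. Qed.

Let graph_openI : setI_closed graph_open.
Proof. by move=> A B oA oB e; rewrite preimage_setI; exact: openI. Qed.

Let graph_open_bigU (I : Type) (f : I -> set gpoint) :
  (forall i, graph_open (f i)) -> graph_open (\bigcup_i f i).
Proof.
move=> oF e; rewrite preimage_bigcup; apply: bigcup_open => i _.
exact: oF.
Qed.

HB.instance Definition _ :=
  isOpenTopological.Build gpoint graph_openT graph_openI graph_open_bigU.

Lemma graph_continuousP (T : topologicalType) (u : gpoint -> T) :
  continuous u <-> forall e, continuous (u \o chart e).
Proof.
split=> [/continuousP cu e|cu]; apply/continuousP => A oA.
  exact: (cu A oA e).
by move=> e; move/continuousP: (cu e); apply.
Qed.

End Points.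

Section Laplacian.
Variables (R : realType) (G : metric_graph R).
Local Notation mu := (@lebesgue_measure R).

Definition square_integrable (a : R) (f : R -> R) : Prop :=
  measurable_fun `[0, a] f /\
  mu.-integrable `[0, a] (EFin \o (fun x => f x ^+ 2)).

Definition L2 (u : gpoint G -> R) : Prop :=
  forall e, square_integrable (len e) (u \o chart e).

Definition edge_int (g : edge G -> R -> R) : R :=
  \sum_(e : edge G) \int[mu]_(x in `[0, len e]) g e x.

Definition inner (u v : gpoint G -> R) : R :=
  edge_int (fun e x => u (chart e x) * v (chart e x)).

(* u belongs to H^1(G) and its weak derivative on the edge e is [g e].  Weak
   derivatives are only defined off the vertices, hence the type of [g]. *)
Definition H1 (u : gpoint G -> R) (g : edge G -> R -> R) : Prop :=
  [/\ continuous u,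
      forall e, square_integrable (len e) (g e) &
      forall e x, 0 <= x <= len e ->
        u (chart e x) = u (chart e 0) + \int[mu]_(y in `[0, x]) g e y].

(* The operator associated to the form ||u'||^2 with domain H^1(G):
   [laplacian u w] means that u is in the domain of -Delta, -Delta u = w. *)
Definition laplacian (u w : gpoint G -> R) : Prop :=
  L2 w /\
  exists2 g, H1 u g &
    forall v k, H1 v k -> edge_int (fun e x => g e x * k e x) = inner w v.

(* Since [laplacian] involves H^1 functions, the psi j are the continuous
   representatives of the eigenfunctions. *)
Definition orthonormal_eigenbasis (lambda : nat -> R)
    (psi : nat -> gpoint G -> R) : Prop :=
  [/\ forall j, laplacian (psi j) (fun q => lambda j * psi j q),
      forall i j, inner (psi i) (psi j) = (i == j)%:R &
      forall f, L2 f ->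
        (fun n => let r := fun q =>
             f q - \sum_(j < n) inner f (psi j) * psi j q in inner r r)
          @ \oo --> (0 : R)].

Definition is_heat_kernel (H : R -> gpoint G -> gpoint G -> R) : Prop :=
  exists lambda psi, orthonormal_eigenbasis lambda psi /\
    forall t q1 q2, 0 < t ->
      H t q1 q2 =
      limn (series (fun j => expR (- t * lambda j) * psi j q1 * psi j q2)).

(* f is differentiable at x relatively to [0, a], with derivative l (one-sided
   if x = 0 or x = a). *)
Definition deriv_on (a : R) (f : R -> R) (x l : R) : Prop :=
  (f y - f x) / (y - x) @[y --> within `[0, a] x^'] --> l.

(* The two ends of the edge e are (e, false), at [src e], and (e, true), at
   [tgt e]; a loop contributes both of them to its vertex. *)
Definition end_vertex (d : edge G * bool) : vertex G :=
  if d.2 then tgt d.1 else src d.1.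

Definition end_chart (d : edge G * bool) (s : R) : gpoint G :=
  chart d.1 (if d.2 then len d.1 - s else s).

Definition outward_derivative (u : gpoint G -> R) (d : edge G * bool) (l : R) :
    Prop :=
  (u (end_chart d s) - u (end_chart d 0)) / s @[s --> 0^'+] --> l.

Definition kirchhoff_neumann (u : gpoint G -> R) : Prop :=
  exists du : edge G * bool -> R,
    (forall d, outward_derivative u d (du d)) /\
    (forall v, \sum_(d | end_vertex d == v) du d = 0).

End Laplacian.

(* Main.v *)
(* On an edge, psi'' = - lambda psi gives (psi^2)''' = - 8 lambda psi psi',
   while e^(- lambda t) (psi^2)' has t-derivative
   - 2 lambda psi psi' e^(- lambda t), so each term of the series of h satisfies
   the equation; and the outward derivatives of psi^2 at a vertex v are 2 psi(v)
   times those of psi.  It remains to differentiate the series term by term.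
   Testing the weak eigenvalue equation against hat functions shows that psi is
   a classical oscillation on each edge, and testing it against functions affine
   on each edge gives the Kirchhoff condition.  On an edge of length a the energy
   psi'^2 + lambda psi^2 is constant, whence psi^2 <= 2 / a and
   psi'^2 <= 2 lambda / a.  Finally \sum_j 1 / (1 + lambda_j) is finite, since
   Sobolev's inequality bounds the diagonal of the resolvent kernel; hence
   \sum_j e^(- t lambda_j) lambda_j^m is finite for all t > 0 and all m. *)
Require Import Defs.
From HB Require Import structures.
From mathcomp Require Import all_boot all_order all_algebra.
From mathcomp Require Import all_classical all_reals all_analysis.
From mathcomp Require Import ring lra.
Import Order.TTheory GRing.Theory Num.Theory.
Import numFieldNormedType.Exports.
Local Open Scope classical_set_scope.
Local Open Scope ring_scope.
Set Implicit Arguments.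
Unset Strict Implicit.
Unset Printing Implicit Defensive.

(** * Term-by-term differentiation *)

(** One argument for three filters: punctured neighbourhoods for [is_derive], their trace on a
    segment for [deriv_on], and right neighbourhoods of 0 for [outward_derivative]. *)
Lemma cvg_linear_error {R : realType} (T : Type) (F : set_system T)
    (q d : T -> R) (l K : R) : Filter F ->
  (\forall s \near F, `|q s - l| <= K * `|d s|) -> d @ F --> (0 : R) ->
  q @ F --> l.
Proof.
move=> FF Hq Hd; apply/cvgrPdist_lt => e e0.
(* [K] may be zero or negative; [|K| + 1] is a positive constant to divide by. *)
have K0 : 0 < `|K| + 1 by rewrite ltr_wpDl.
move/cvgrPdist_lt : Hd => /(_ _ (divr_gt0 e0 K0)) Hd'.
near=> s.
have h1 : `|q s - l| <= K * `|d s| by near: s.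
have h2 : `|0 - d s| < e / (`|K| + 1) by near: s; exact: Hd'.
rewrite distrC (le_lt_trans h1)//.
rewrite sub0r normrN ltr_pdivlMr// mulrC in h2.
apply: le_lt_trans h2.
by rewrite ler_wpM2r// (le_trans (ler_norm _))// lerDl.
Unshelve. all: by end_near. Qed.

(** A quadratic error bound is an inequality, so it survives summation of a series. Being two-sided,
    it also yields the derivatives relative to a segment and the outward derivatives at its ends. *)
Definition quad_approx {R : realType} (f : R -> R) (x l : R) : Prop :=
  exists K r : R, 0 < r /\
    forall z, `|z - x| < r -> `|f z - f x - l * (z - x)| <= K * (z - x) ^+ 2.

Lemma quad_approx_quotient {R : realType} (f : R -> R) (x l K z : R) :
  z != x -> `|f z - f x - l * (z - x)| <= K * (z - x) ^+ 2 ->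
  `|(f z - f x) / (z - x) - l| <= K * `|z - x|.
Proof.
rewrite -subr_eq0 => zx.
have -> : (f z - f x) / (z - x) - l = (f z - f x - l * (z - x)) / (z - x).
  by field.
rewrite normrM normfV ler_pdivrMr ?normr_gt0// -mulrA -expr2.
by rewrite real_normK ?num_real.
Qed.

Lemma quad_approx_is_derive {R : realType} (f : R -> R) (x l : R) :
  quad_approx f x l -> is_derive x 1 f l.
Proof.
move=> [K [r [r0 H]]].
have Hc : (fun h : R => h^-1 *: (f (h *: (1 : R) + x) - f x)) @ 0^' --> l.
  apply: (@cvg_linear_error _ _ _ _ (fun h => h) _ K).
    near=> h.
    have h0 : h != 0 by near: h; exact: nbhs_dnbhs_neq.
    have hr : `|h| < r.
      near: h; apply: nbhs_dnbhs; exists r => //= h /=.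
      by rewrite sub0r normrN.
    have := @quad_approx_quotient _ f x l K (h + x).
    rewrite /GRing.scale/= mulr1 addrK.
    rewrite (mulrC _^-1); apply.
      by rewrite -subr_eq0 addrK.
    by have := H (h + x); rewrite addrK; apply.
  by apply: cvg_within_filter; exact: cvg_id.
apply: DeriveDef; first by apply/cvg_ex; exists l; exact: Hc.
exact: cvg_lim Hc.
Unshelve. all: by end_near. Qed.

(** Here [f] is a function clamped outside the edge and [F] a smooth continuation of it, so the
    endpoints of the segment need no separate treatment. *)
Lemma quad_approx_deriv_on {R : realType} (a : R) (f F : R -> R) (x l : R) :
  {in `[0, a], f =1 F} -> x \in `[0, a] -> quad_approx F x l ->
  deriv_on a f x l.
Proof.
move=> fF xa [K [r [r0 H]]].
apply: (@cvg_linear_error _ _ _ _ (fun y => y - x) _ K); last first.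
  apply: cvg_within_filter; apply: cvg_within_filter.
  rewrite -{2}(subrr x).
  by apply: cvgB; [exact: cvg_id|exact: cvg_cst].
near=> y.
have yx : y != x by near: y; apply: cvg_within; exact: withinT.
have ya : y \in `[0, a] by near: y; exact: withinT.
have yr : `|y - x| < r.
  near: y; apply: cvg_within; apply: nbhs_dnbhs; exists r => //= y /=.
  by rewrite distrC.
by rewrite !fF//; apply: quad_approx_quotient => //; exact: H.
Unshelve. all: by end_near. Qed.

Lemma is_derive_continuous {R : realType} (f : R -> R) (x l : R) :
  is_derive x 1 f l -> {for x, continuous f}.
Proof.
move=> [+ _] => /derivable1_diffP.
exact: differentiable_continuous.
Qed.

Lemma MVT_ball {R : realType} (f df : R -> R) (x r z : R) :
  (forall z, `|z - x| < r -> is_derive z 1 f (df z)) -> `|z - x| < r ->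
  exists c, `|c - x| <= `|z - x| /\ f z - f x = df c * (z - x).
Proof.
move=> fd zr.
have [xz|zx] := leP x z.
  have fd' c : c \in `[x, z] -> is_derive c 1 f (df c).
    rewrite in_itv /= => /andP[xc cz]; apply: fd.
    by rewrite (le_lt_trans _ zr)// !ger0_norm ?subr_ge0// lerD2r.
  have dfo c : c \in `]x, z[ -> is_derive c 1 f (df c).
    by move=> cI; apply: fd'; exact: subset_itv_oo_cc cI.
  have cf : {within `[x, z], continuous f}.
    by apply: derivable_within_continuous => c /fd'[].
  have [c] := MVT_segment xz dfo cf.
  rewrite in_itv /= => /andP[xc cz] ->; exists c; split => //.
  by rewrite !ger0_norm ?subr_ge0// lerD2r.
have fd' c : c \in `[z, x] -> is_derive c 1 f (df c).
  rewrite in_itv /= => /andP[zc cx]; apply: fd.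
  rewrite (le_lt_trans _ zr)// !ler0_norm ?subr_le0 ?(ltW zx)//.
  by rewrite lerN2 lerD2r.
have dfo c : c \in `]z, x[ -> is_derive c 1 f (df c).
  by move=> cI; apply: fd'; exact: subset_itv_oo_cc cI.
have cf : {within `[z, x], continuous f}.
  by apply: derivable_within_continuous => c /fd'[].
have [c] := MVT_segment (ltW zx) dfo cf.
rewrite in_itv /= => /andP[zc cx] E; exists c; split => //.
  by rewrite !ler0_norm ?subr_le0 ?(ltW zx)// lerN2 lerD2r.
by rewrite -opprB E -mulrN opprB.
Qed.

(** The mean value theorem is applied to [f] and then to [f'], with intermediate points that stay in
    the ball. This gives the constant [M], where Taylor's formula would give [M / 2]. *)
Lemma taylor1_bound {R : realType} (f f' f'' : R -> R) (x r M z : R) :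
  (forall z, `|z - x| < r -> is_derive z 1 f (f' z)) ->
  (forall z, `|z - x| < r -> is_derive z 1 f' (f'' z)) ->
  (forall z, `|z - x| < r -> `|f'' z| <= M) ->
  `|z - x| < r ->
  `|f z - f x - f' x * (z - x)| <= M * (z - x) ^+ 2.
Proof.
move=> d1 d2 bM zr.
have [c [cz ->]] := MVT_ball d1 zr.
have cr := le_lt_trans cz zr.
have [c' [c'c E]] := MVT_ball d2 cr.
have bc' := bM _ (le_lt_trans c'c cr).
rewrite -mulrBl E !normrM -(real_normK (num_real (z - x))) expr2 mulrA.
rewrite ler_wpM2r//; apply: ler_pM => //.
Qed.

Lemma cvg_series_dominated {R : realType} (u v : nat -> R) :
  (forall n, `|u n| <= v n) -> cvgn (series v) -> cvgn (series u).
Proof.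
move=> uv cv; apply: normed_cvg; apply: (series_le_cvg _ _ uv cv) => n //.
exact: le_trans (uv n).
Qed.

(** The Taylor bounds of the terms add up to a bound for the partial sums. Both sides then pass to
    the limit, with the sum of [M] as the constant. *)
Lemma quad_approx_series {R : realType} (f f' f'' : nat -> R -> R)
    (M : nat -> R) (x r : R) : 0 < r ->
  (forall n z, `|z - x| < r -> is_derive z 1 (f n) (f' n z)) ->
  (forall n z, `|z - x| < r -> is_derive z 1 (f' n) (f'' n z)) ->
  (forall n z, `|z - x| < r -> `|f'' n z| <= M n) ->
  cvgn (series M) ->
  (forall z, `|z - x| < r -> cvgn (series (f ^~ z))) ->
  cvgn (series (f' ^~ x)) ->
  quad_approx (fun z => limn (series (f ^~ z))) x (limn (series (f' ^~ x))).
Proof.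
move=> r0 d1 d2 bM cM cf cf'; exists (limn (series M)), r; split=> // z zr.
have cfx : cvgn (series (f ^~ x)) by apply: cf; rewrite subrr normr0.
pose g n := (series (f ^~ z) n - series (f ^~ x) n -
             series (f' ^~ x) n * (z - x)).
have cg : g @ \oo --> limn (series (f ^~ z)) - limn (series (f ^~ x)) -
   limn (series (f' ^~ x)) * (z - x).
  apply: cvgB; first by apply: cvgB; [exact: cf|exact: cfx].
  by apply: cvgM => //; exact: cvg_cst.
have cMz : (fun n => series M n * (z - x) ^+ 2) @ \oo -->
    limn (series M) * (z - x) ^+ 2.
  by apply: cvgM => //; exact: cvg_cst.
rewrite -(cvg_lim _ cMz)// -(cvg_lim _ (cvg_norm cg))//.
apply: ler_lim.
- by apply/cvg_ex; eexists; exact: (cvg_norm cg).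
- by apply/cvg_ex; eexists; exact: cMz.
apply: nearW => n; rewrite /g /series /= -!sumrB !mulr_suml -sumrB.
apply: le_trans (ler_norm_sum _ _ _) _; apply: ler_sum => i _.
by apply: (taylor1_bound (d1 i) (d2 i) (bM i)).
Qed.

(** With [w = s * (1 + L) / 4], the left side is [expR s] times the fourth power of
    [expR (- w) * (1 + L)], and [expR w >= w] bounds this last product by [4 / s]. *)
Lemma expR_poly4_bound {R : realType} (s L : R) : 0 < s -> 0 <= L ->
  expR (- s * L) * (1 + L) ^+ 4 <= expR s * (4 / s) ^+ 4.
Proof.
move=> s0 L0.
have L1 : 0 <= 1 + L by rewrite addr_ge0.
have E : expR (- s * L) = expR s * expR (- (s * (1 + L) / 4)) ^+ 4.
  by rewrite -expRM_natl -expRD; congr expR; field.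
rewrite E -mulrA -exprMn ler_wpM2l ?expR_ge0// lerXn2r ?nnegrE//.
- by rewrite mulr_ge0 ?expR_ge0.
- by rewrite divr_ge0// ltW.
rewrite expRN mulrC ler_pdivrMr ?expR_gt0// mulrAC ler_pdivlMr//.
have := expR_ge1Dx (s * (1 + L) / 4).
have : 0 <= s * (1 + L) by rewrite mulr_ge0// ltW.
lra.
Qed.

(** * Integrals over a segment *)

Section SegmentIntegral.
Context {R : realType}.
Implicit Types (a x y : R) (f g F : R -> R).
Local Notation mu := (@lebesgue_measure R).

Definition seg_integrable a f : Prop := mu.-integrable `[0, a] (EFin \o f).

Definition seg_int a f : R := \int[mu]_(x in `[0, a]) f x.

Lemma continuous_seg_integrable a f : continuous f -> seg_integrable a f.
Proof.
move=> cf; apply: continuous_compact_integrable; first exact: segment_compact.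
exact: continuous_subspaceT.
Qed.

Lemma seg_integrableD a f g : seg_integrable a f -> seg_integrable a g ->
  seg_integrable a (fun x => f x + g x).
Proof. by move=> If Ig; exact: integrableD If Ig. Qed.

Lemma seg_integrableZ a r f : seg_integrable a f ->
  seg_integrable a (fun x => r * f x).
Proof. by move=> If; exact: integrableZl If. Qed.

Lemma truncate_restrict f y :
  (fun x => if x <= y then f x else 0) = f \_ [set x | x <= y].
Proof.
apply/funext => x; rewrite /patch; case: ifPn => xy.
  by rewrite ifT// inE.
by rewrite ifF//; apply/negP; rewrite inE /= => /idPn; rewrite xy.
Qed.

Lemma seg_integrable_truncate a f y : seg_integrable a f ->
  seg_integrable a (fun x => if x <= y then f x else 0).
Proof.
move=> If; rewrite /seg_integrable truncate_restrict.
have mle : measurable [set x : R | x <= y].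
  by rewrite -[X in measurable X]set_itvNyc.
have -> : EFin \o (f \_ [set x | x <= y]) = (EFin \o f) \_ [set x | x <= y].
  by rewrite restrict_EFin.
apply/integrable_restrict => //.
by apply: integrableS If => //; exact: measurableI.
Qed.

Lemma eq_seg_int a f g : (forall x, 0 <= x <= a -> f x = g x) ->
  seg_int a f = seg_int a g.
Proof.
by move=> fg; apply: eq_Rintegral => x; rewrite inE /= in_itv/= => /fg.
Qed.

Lemma seg_intD a f g : seg_integrable a f -> seg_integrable a g ->
  seg_int a (fun x => f x + g x) = seg_int a f + seg_int a g.
Proof. by move=> If Ig; rewrite /seg_int RintegralD. Qed.

Lemma seg_intB a f g : seg_integrable a f -> seg_integrable a g ->
  seg_int a (fun x => f x - g x) = seg_int a f - seg_int a g.
Proof. by move=> If Ig; rewrite /seg_int RintegralB. Qed.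

Lemma seg_intZ a r f : seg_integrable a f ->
  seg_int a (fun x => r * f x) = r * seg_int a f.
Proof. by move=> If; rewrite /seg_int RintegralZl. Qed.

Lemma seg_integrable_sum (I : Type) (r : seq I) a (f : I -> R -> R) :
  (forall i, seg_integrable a (f i)) ->
  seg_integrable a (fun x => \sum_(i <- r) f i x).
Proof.
move=> If; elim: r => [|i r IHr].
  under eq_fun do rewrite big_nil.
  by apply: continuous_seg_integrable; exact: cst_continuous.
under eq_fun do rewrite big_cons.
exact: seg_integrableD.
Qed.

Lemma seg_int_sum (I : Type) (r : seq I) a (f : I -> R -> R) :
  (forall i, seg_integrable a (f i)) ->
  seg_int a (fun x => \sum_(i <- r) f i x) = \sum_(i <- r) seg_int a (f i).
Proof.
move=> If; elim: r => [|i r IHr].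
  rewrite big_nil; under eq_fun do rewrite big_nil.
  by rewrite /seg_int /Rintegral integral0.
rewrite big_cons -IHr; under eq_fun do rewrite big_cons.
by rewrite seg_intD//; exact: seg_integrable_sum.
Qed.

Lemma seg_int_cst a c : 0 <= a -> seg_int a (fun=> c) = c * a.
Proof.
move=> a0; rewrite /seg_int Rintegral_cst//=; congr (_ * _).
rewrite lebesgue_measure_itv/= lte_fin; case: ltP => [_|a0'] /=.
  by rewrite oppr0 addr0.
by apply/eqP; rewrite eq_le a0 a0'.
Qed.

Lemma le_seg_int a f g : seg_integrable a f -> seg_integrable a g ->
  (forall x, 0 <= x <= a -> f x <= g x) -> seg_int a f <= seg_int a g.
Proof.
by move=> If Ig fg; apply: le_Rintegral.
Qed.

Lemma seg_int_ge0 a f : (forall x, 0 <= x <= a -> 0 <= f x) ->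
  0 <= seg_int a f.
Proof.
by move=> f0; apply: Rintegral_ge0 => x; rewrite /= in_itv/= => /f0.
Qed.

(** The minimum covers [a < y], which occurs when the derivative of a hat is integrated up to a
    point left of its peak. *)
Lemma seg_int_truncate a f y :
  seg_int a (fun x => if x <= y then f x else 0) = seg_int (Num.min a y) f.
Proof.
rewrite /seg_int truncate_restrict -Rintegral_mkcondr.
congr (Rintegral _ _ _); apply/seteqP; split => x /=; rewrite !in_itv/= le_min.
  by move=> [/andP[-> ->] ->].
by move=> /and3P[-> -> ->].
Qed.

(** On a bounded segment the integrable function [1 + f ^+ 2] dominates [|f|]. *)
Lemma seg_integrable_sqr a f : square_integrable a f -> seg_integrable a f.
Proof.
move=> [mf If2].
have I1 : seg_integrable a (fun x => 1 + f x ^+ 2).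
  apply: seg_integrableD => //; apply: continuous_seg_integrable.
  exact: cst_continuous.
apply: le_integrable I1 => //; first exact/measurable_realfun.measurable_EFinP.
move=> x _ /=; rewrite lee_fin.
rewrite [leRHS]ger0_norm; last by rewrite addr_ge0 ?sqr_ge0.
have := sqr_ge0 (`|f x| - 1); rewrite -(real_normK (num_real (f x))).
have := sqr_ge0 (`|f x|).
rewrite !expr2; lra.
Qed.

Lemma seg_int_FTC2 a f F : 0 < a -> continuous f ->
  (forall x, is_derive x 1 F (f x)) -> seg_int a f = F a - F 0.
Proof.
move=> a0 cf dF.
have cF x : {for x, continuous F} := is_derive_continuous (dF x).
rewrite /seg_int /Rintegral (@continuous_FTC2 _ _ F)//.
- exact: continuous_subspaceT.
- split; first by move=> x _; case: (dF x).
  + exact/cvg_at_right_filter/cF.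
  + exact/cvg_at_left_filter/cF.
- by move=> x _; rewrite derive1E; apply: derive_val.
Qed.

Lemma exists_antiderivative a f : 0 < a -> continuous f ->
  exists F, forall y, 0 <= y <= a ->
    is_derive y 1 F (f y) /\ seg_int y f = F y - F 0.
Proof.
(* Starting the integral at -1 makes 0 an interior point, so the derivative is two-sided on the
   whole closed segment. *)
move=> a0 cf; exists (fun y => \int[mu]_(t in `[-1, y]) f t) => y /andP[y0 ya].
have If b c : mu.-integrable `[b, c] (EFin \o f).
  apply: continuous_compact_integrable; first exact: segment_compact.
  exact: continuous_subspaceT.
split.
  have [| | | |d1 d2] := @continuous_FTC1_closed _ f (-1) y (a + 1).
  - by rewrite (le_lt_trans ya)// ltrDl.
  - exact: If.
  - by rewrite (lt_le_trans _ y0)// ltrN10.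
  - exact: cf.
  - by apply: DeriveDef; [exact: d1|rewrite -derive1E; exact: d2].
rewrite Rintegral_itvB//.
- rewrite Rintegral_itv_obnd_cbnd//.
  apply: integrableS (If 0 y) => //.
  by apply: subset_itvr; rewrite bnd_simp.
- by rewrite bnd_simp.
Qed.

End SegmentIntegral.

(** * Test functions on a metric graph *)

Section TestFunctions.
Context {R : realType} {G : metric_graph R}.
Implicit Types (c : vertex G -> R) (f k g : edge G -> R -> R) (e : edge G).
Implicit Types (u psi : gpoint G -> R).

Lemma continuous_minr_cst (a : R) : continuous (fun x : R => Num.min x a).
Proof.
move=> x; apply: (@continuous_min _ _ (fun x : R => x) (fun=> a)).
  exact: cvg_id.
exact: cst_continuous.
Qed.

(** The retraction of the line onto [[0, a]] through which every chart factors. It turns formulas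
    valid on the closed edge into formulas on the whole line, where continuity is tested. *)
Definition clamp (a x : R) : R := Num.max 0 (Num.min x a).

Lemma clamp_itv (a x : R) : 0 <= a -> 0 <= clamp a x <= a.
Proof.
by move=> a0; rewrite /clamp le_max lexx/= ge_max a0 ge_min lexx orbT.
Qed.

Lemma clamp_id (a x : R) : 0 <= x <= a -> clamp a x = x.
Proof. by move=> /andP[x0 xa]; rewrite /clamp min_l// max_r. Qed.

Lemma clamp_continuous (a : R) : continuous (clamp a).
Proof.
move=> x; apply: (@continuous_max _ _ (fun=> 0) (fun x => Num.min x a)).
  exact: cst_continuous.
exact: continuous_minr_cst.
Qed.

Lemma chart_le0 e (x : R) : x <= 0 -> chart e x = vpt (src e).
Proof.
move=> x0; apply: val_inj; rewrite /chart val_insubd /= x0.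
by rewrite ltNge x0.
Qed.

Lemma chart_ge_len e (x : R) : len e <= x -> chart e x = vpt (tgt e).
Proof.
move=> xl; apply: val_inj; rewrite /chart val_insubd /= [x < _]ltNge xl andbF.
by rewrite leNgt (lt_le_trans (len_gt0 e) xl).
Qed.

Lemma chart_clamp e (x : R) : chart e x = chart e (clamp (len e) x).
Proof.
have l0 := ltW (len_gt0 e).
have [x0|x0] := leP x 0.
  rewrite (chart_le0 _ x0) chart_le0// /clamp ge_max lexx ge_min x0//.
have [xl|xl] := leP (len e) x.
  by rewrite (chart_ge_len xl) chart_ge_len// /clamp (min_r xl) max_r.
by rewrite clamp_id// !ltW.
Qed.

Definition glue c f (p : gpoint G) : R :=
  match sval p with
  | inl v => c v
  | inr (e, x) => f e x
  end.

Lemma glue_chart c f e (x : R) :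
  f e 0 = c (src e) -> f e (len e) = c (tgt e) -> 0 <= x <= len e ->
  glue c f (chart e x) = f e x.
Proof.
move=> f0 fl /andP[x0 xl].
have [x0'|x0'] := leP x 0.
  by rewrite chart_le0//= /glue/= -f0; congr f; apply/eqP; rewrite eq_le x0 x0'.
have [xl'|xl'] := leP (len e) x.
  rewrite chart_ge_len//= /glue/= -fl; congr f.
  by apply/eqP; rewrite eq_le xl xl'.
have -> : chart e x = exist _ (inr (e, x)) (introT andP (conj x0' xl')).
  by apply: val_inj; rewrite /chart val_insubd/= x0' xl'.
by [].
Qed.

Lemma glue_continuous c f :
  (forall e, f e 0 = c (src e)) -> (forall e, f e (len e) = c (tgt e)) ->
  (forall e, continuous (f e)) -> continuous (glue c f).
Proof.
move=> f0 fl cf; apply/graph_continuousP => e.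
have -> : glue c f \o chart e = f e \o clamp (len e).
  apply/funext => x /=; rewrite chart_clamp glue_chart//.
  exact/clamp_itv/ltW/len_gt0.
by move=> x; apply: continuous_comp; [exact: clamp_continuous|exact: cf].
Qed.

Lemma glue_H1 c f k :
  (forall e, f e 0 = c (src e)) -> (forall e, f e (len e) = c (tgt e)) ->
  (forall e, continuous (f e)) ->
  (forall e, square_integrable (len e) (k e)) ->
  (forall e x, 0 <= x <= len e -> f e x = f e 0 + seg_int x (k e)) ->
  H1 (glue c f) k.
Proof.
move=> f0 fl cf sk fk; split=> //; first exact: glue_continuous.
move=> e x xe; rewrite !glue_chart//; first exact: fk.
by rewrite lexx ltW ?len_gt0.
Qed.

Lemma continuous_square_integrable (a : R) (h : R -> R) :
  continuous h -> square_integrable a h.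
Proof.
move=> ch; split.
  apply: measurable_funTS.
  exact: measurable_realfun.continuous_measurable_fun.
apply: continuous_seg_integrable => x.
by rewrite /GRing.exp/=; apply: cvgM; exact: ch.
Qed.

Definition affine_on c e (x : R) : R :=
  c (src e) + (c (tgt e) - c (src e)) / len e * x.

Lemma affine_on0 c e : affine_on c e 0 = c (src e).
Proof. by rewrite /affine_on mulr0 addr0. Qed.

Lemma affine_on_len c e : affine_on c e (len e) = c (tgt e).
Proof.
by rewrite /affine_on divfK ?gt_eqF ?len_gt0// addrC subrK.
Qed.

Lemma affine_H1 c : H1 (glue c (affine_on c))
  (fun e _ => (c (tgt e) - c (src e)) / len e).
Proof.
apply: glue_H1.
- exact: affine_on0.
- exact: affine_on_len.
- move=> e x; apply: cvgD; first exact: cvg_cst.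
  by apply: cvgM; [exact: cvg_cst|exact: cvg_id].
- by move=> e; apply: continuous_square_integrable; exact: cst_continuous.
- by move=> e x /andP[x0 _]; rewrite affine_on0 seg_int_cst.
Qed.

(** The Green function of [- d^2/dz^2] on [[0, a]] with Dirichlet conditions and pole [y]. *)
Definition hat (a y z : R) : R := Num.min z y - y / a * z.

Definition hat' (a y z : R) : R := (if z <= y then 1 else 0) - y / a.

Lemma hat0 (a y : R) : 0 <= y -> hat a y 0 = 0.
Proof. by move=> y0; rewrite /hat min_l// mulr0 subr0. Qed.

Lemma hat_end (a y : R) : 0 < a -> y <= a -> hat a y a = 0.
Proof. by move=> a0 ya; rewrite /hat min_r// divfK ?subrr// gt_eqF. Qed.

Lemma seg_integrable_cst (a r : R) : seg_integrable a (fun=> r).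
Proof. by apply: continuous_seg_integrable; exact: cst_continuous. Qed.

Lemma hat_eq_int (a y z : R) : 0 <= y -> 0 <= z ->
  hat a y z = seg_int z (hat' a y).
Proof.
move=> y0 z0; rewrite /hat /hat' seg_intB; last 2 first.
- by apply: seg_integrable_truncate; exact: seg_integrable_cst.
- exact: seg_integrable_cst.
by rewrite seg_int_truncate !seg_int_cst ?mul1r// le_min z0.
Qed.

Lemma hat'_square_integrable (a y : R) : square_integrable a (hat' a y).
Proof.
have It r : seg_integrable a (fun x => if x <= y then r else 0).
  by apply: seg_integrable_truncate; exact: seg_integrable_cst.
split.
  have : seg_integrable a (hat' a y).
    by apply: seg_integrableD; [exact: It|exact: seg_integrable_cst].
  by move=> /integrableP[/measurable_realfun.measurable_EFinP].
have -> : (fun x => hat' a y x ^+ 2) =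
    (fun x => (if x <= y then 1 - (y / a) *+ 2 else 0) + (y / a) ^+ 2).
  by apply/funext => x; rewrite /hat'; case: ifP => _; ring.
by apply: seg_integrableD; [exact: It|exact: seg_integrable_cst].
Qed.

(** The hat vanishes at both ends of its edge, so its extension by zero is continuous at the
    vertices, also when the edge is a loop. *)
Lemma hat_H1 e (y : R) : 0 <= y <= len e ->
  H1 (glue (fun=> 0) (fun e' => if e' == e then hat (len e) y else fun=> 0))
     (fun e' => if e' == e then hat' (len e) y else fun=> 0).
Proof.
move=> /andP[y0 ye]; apply: glue_H1 => e';
  have [e'e|_] := eqVneq e' e; rewrite ?e'e//.
- exact: hat0.
- exact: hat_end (len_gt0 e) ye.
- move=> x; apply: cvgB.
    exact: continuous_minr_cst.
  by apply: cvgM; [exact: cvg_cst|exact: cvg_id].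
- exact: cst_continuous.
- exact: hat'_square_integrable.
- exact/continuous_square_integrable/cst_continuous.
- by move=> x /andP[x0 _]; rewrite hat0// add0r hat_eq_int.
- by move=> x /andP[x0 _]; rewrite seg_int_cst// mul0r addr0.
Qed.

(** * Testing the weak eigenvalue equation *)

Section WeakForm.
Variables (psi : gpoint G -> R) (g : edge G -> R -> R) (lam : R).
Hypothesis psiH1 : H1 psi g.
Hypothesis weak : forall v k, H1 v k ->
  edge_int (fun e x => g e x * k e x) = inner (fun q => lam * psi q) v.

Lemma H1_int e (x : R) : 0 <= x <= len e ->
  seg_int x (g e) = psi (chart e x) - psi (chart e 0).
Proof.
case: psiH1 => _ _ /[apply] ->.
by rewrite addrAC subrr add0r.
Qed.

(** The test function has constant slope on each edge, so the Dirichlet form only sees the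
    increments of [psi] along the edges. *)
Lemma weak_affine c :
  \sum_e (c (tgt e) - c (src e)) / len e *
    (psi (chart e (len e)) - psi (chart e 0)) =
  \sum_e seg_int (len e) (fun x => lam * psi (chart e x) * affine_on c e x).
Proof.
have := weak (affine_H1 c); rewrite /edge_int /inner /edge_int => E.
transitivity (\sum_e seg_int (len e)
    (fun x => g e x * ((c (tgt e) - c (src e)) / len e))).
  apply: eq_bigr => e _; rewrite -H1_int ?lexx ?ltW ?len_gt0//.
  rewrite -seg_intZ; first by apply: eq_seg_int => x _; rewrite mulrC.
  by case: psiH1 => _ /(_ e)/seg_integrable_sqr.
rewrite [LHS]E; apply: eq_bigr => e _; apply: eq_seg_int => x xe.
by rewrite glue_chart// (affine_on0, affine_on_len).
Qed.

(** The slope of the hat is the indicator of [[0, y]] minus [y / len e], so the Dirichlet form is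
    the deviation of [psi] at [y] from its chord. The result is the Green representation of [psi] on
    the edge. *)
Lemma weak_hat e (y : R) : 0 <= y <= len e ->
  psi (chart e y) - psi (chart e 0) -
    y / len e * (psi (chart e (len e)) - psi (chart e 0)) =
  seg_int (len e) (fun z => lam * psi (chart e z) * hat (len e) y z).
Proof.
move=> ye; have := weak (hat_H1 ye); rewrite /edge_int /inner /edge_int.
have gI : seg_integrable (len e) (g e).
  by case: psiH1 => _ /(_ e)/seg_integrable_sqr.
rewrite (bigD1 e)//= [X in _ + X = _]big1 ?addr0; last first.
  move=> e' /negPf ->; rewrite -[LHS]/(seg_int _ _).
  under eq_fun do rewrite mulr0.
  by rewrite seg_int_cst ?mul0r// ltW ?len_gt0.
rewrite eqxx [X in _ = X](bigD1 e)//= [X in _ = _ + X]big1 ?addr0; last first.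
  move=> e' /negPf e'e; rewrite -[LHS]/(seg_int _ _).
  rewrite (@eq_seg_int _ _ _ (fun=> 0)).
    by rewrite seg_int_cst ?mul0r// ltW ?len_gt0.
  by move=> x xe; rewrite glue_chart// e'e// mulr0.
move=> E.
rewrite -H1_int// -H1_int ?lexx ?ltW ?len_gt0//.
transitivity (seg_int (len e) (fun x => g e x * hat' (len e) y x)).
  have -> : (fun x => g e x * hat' (len e) y x) =
      (fun x => (if x <= y then g e x else 0) - y / len e * g e x).
    by apply/funext => x; rewrite /hat'; case: ifP => _; ring.
  rewrite seg_intB ?seg_intZ ?seg_int_truncate//.
  - by rewrite min_r//; case/andP: ye.
  - exact: seg_integrable_truncate.
  - exact: seg_integrableZ.
rewrite [LHS]E; apply: eq_seg_int => x xe.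
case/andP: ye => y0 ye.
by rewrite glue_chart ?eqxx ?hat0 ?hat_end// len_gt0.
Qed.

End WeakForm.

End TestFunctions.

(** * Regularity of weak solutions on an edge *)

Section HarmonicOscillator.
Context {R : realType}.
Implicit Types (f g p : R -> R) (x a lam : R).

Lemma is_derive_addf f g x df dg : is_derive x 1 f df -> is_derive x 1 g dg ->
  is_derive x 1 (fun z => f z + g z) (df + dg).
Proof. by move=> hf hg; exact: is_deriveD. Qed.

Lemma is_derive_subf f g x df dg : is_derive x 1 f df -> is_derive x 1 g dg ->
  is_derive x 1 (fun z => f z - g z) (df - dg).
Proof. by move=> hf hg; exact: is_deriveB. Qed.

Lemma is_derive_mulf f g x df dg : is_derive x 1 f df -> is_derive x 1 g dg ->
  is_derive x 1 (fun z => f z * g z) (f x * dg + g x * df).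
Proof. by move=> hf hg; exact: is_deriveM. Qed.

Lemma is_derive_scalef c f x df : is_derive x 1 f df ->
  is_derive x 1 (fun z => c * f z) (c * df).
Proof. by move=> hf; exact: is_deriveZ. Qed.

Lemma is_derive0_segment f a x : (forall z, 0 <= z <= a -> is_derive z 1 f 0) ->
  0 <= x <= a -> f x = f 0.
Proof.
move=> df /andP[x0 xa].
have dfx z : z \in `[0, x] -> is_derive z 1 f 0.
  by rewrite in_itv/= => /andP[z0 zx]; apply: df; rewrite z0 (le_trans zx).
have dfo z : z \in `]0, x[ -> is_derive z 1 f ((fun=> 0) z).
  by move=> zI; apply: dfx; exact: subset_itv_oo_cc zI.
have cf : {within `[0, x], continuous f}.
  by apply: derivable_within_continuous => z /dfx[].
have [c _] := MVT_segment x0 dfo cf.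
by rewrite mul0r => /eqP; rewrite subr_eq0 => /eqP.
Qed.

Definition osc_cos lam x : R := cos (Num.sqrt lam * x).

(** Together with [osc_cos], the fundamental system of [y'' = - lam y] normalized at 0. At [lam = 0]
    the quotient is replaced by its limit. *)
Definition osc_sin lam x : R :=
  if lam == 0 then x else sin (Num.sqrt lam * x) / Num.sqrt lam.

Lemma is_derive_scale_arg c f df x : is_derive (c * x) 1 f df ->
  is_derive x 1 (fun z => f (c * z)) (c * df).
Proof.
move=> hf; have hc : is_derive x 1 (fun z : R => c * z) c.
  apply: (is_derive_eq (is_derive_scalef c (is_derive_id x (1 : R)))).
  by rewrite mulr1.
rewrite mulrC; exact: (@is_derive1_comp _ f _ _ _ _ hf hc).
Qed.

Lemma is_derive_osc_cos lam x : 0 <= lam ->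
  is_derive x 1 (osc_cos lam) (- lam * osc_sin lam x).
Proof.
move=> l0; apply: (is_derive_eq (is_derive_scale_arg (is_derive_cos _))).
rewrite /osc_sin; case: eqVneq => [->|lN0].
  by rewrite sqrtr0 oppr0 !mul0r.
have s0 : Num.sqrt lam != 0 by rewrite sqrtr_eq0 -ltNge lt_def lN0.
by rewrite -[X in - X * _](sqr_sqrtr l0); field.
Qed.

Lemma is_derive_osc_sin lam x : 0 <= lam ->
  is_derive x 1 (osc_sin lam) (osc_cos lam x).
Proof.
move=> l0; rewrite /osc_sin /osc_cos; case: eqVneq => [->|lN0].
  by rewrite sqrtr0 mul0r cos0; exact: is_derive_id.
have s0 : Num.sqrt lam != 0 by rewrite sqrtr_eq0 -ltNge lt_def lN0.
have -> : (fun z => sin (Num.sqrt lam * z) / Num.sqrt lam) =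
    (fun z => (Num.sqrt lam)^-1 * sin (Num.sqrt lam * z)).
  by apply/funext => z; rewrite mulrC.
apply: (is_derive_eq (is_derive_scalef _
  (is_derive_scale_arg (is_derive_sin _)))).
by rewrite mulrA mulVf// mul1r.
Qed.

Lemma osc_pythagoras lam x : 0 <= lam ->
  osc_cos lam x ^+ 2 + lam * osc_sin lam x ^+ 2 = 1.
Proof.
move=> l0; rewrite /osc_sin /osc_cos; case: eqVneq => [->|lN0].
  by rewrite sqrtr0 mul0r cos0 mul0r addr0 expr1n.
have s0 : Num.sqrt lam != 0 by rewrite sqrtr_eq0 -ltNge lt_def lN0.
rewrite -[RHS](cos2Dsin2 (Num.sqrt lam * x)); congr (_ + _).
by rewrite exprMn exprVn sqr_sqrtr// mulrCA mulfV// mulr1.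
Qed.

(** The equation is imposed on the whole line, so that two-sided derivatives are available at the
    ends of an edge. *)
Definition oscillation lam (y y' : R -> R) : Prop :=
  forall x, is_derive x 1 y (y' x) /\ is_derive x 1 y' (- lam * y x).

(** The coordinates [A] and [B] of [(f, f')] in the fundamental system have zero derivative on the
    segment. The Wronskian is 1 by [osc_pythagoras], so the constants [f 0] and [f' 0] recover
    [f]. *)
Lemma oscillation_extension lam a (f f' : R -> R) : 0 <= lam -> 0 <= a ->
  (forall x, 0 <= x <= a -> is_derive x 1 f (f' x)) ->
  (forall x, 0 <= x <= a -> is_derive x 1 f' (- lam * f x)) ->
  exists y y', oscillation lam y y' /\ forall x, 0 <= x <= a -> f x = y x.
Proof.
move=> l0 a0 df df'.
pose y x := f 0 * osc_cos lam x + f' 0 * osc_sin lam x.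
pose y' x := f' 0 * osc_cos lam x - (lam * f 0) * osc_sin lam x.
exists y, y'; split=> x.
  have dc := is_derive_osc_cos x l0; have ds := is_derive_osc_sin x l0.
  split.
    apply: (is_derive_eq (is_derive_addf (is_derive_scalef _ dc)
      (is_derive_scalef _ ds))).
    by rewrite /y'; ring.
  apply: (is_derive_eq (is_derive_subf (is_derive_scalef _ dc)
    (is_derive_scalef _ ds))).
  by rewrite /y; ring.
move=> xa; have pyth := osc_pythagoras x l0.
have c0 : osc_cos lam 0 = 1 by rewrite /osc_cos mulr0 cos0.
have s0 : osc_sin lam 0 = 0.
  by rewrite /osc_sin mulr0 sin0 mul0r; case: eqP.
pose A z := f z * osc_cos lam z - f' z * osc_sin lam z.
pose B z := f' z * osc_cos lam z + (lam * f z) * osc_sin lam z.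
have Ax : A x = f 0.
  transitivity (A 0); last by rewrite /A c0 s0 mulr1 mulr0 subr0.
  apply: is_derive0_segment xa => z za; have dc := is_derive_osc_cos z l0.
  have ds := is_derive_osc_sin z l0.
  apply: (is_derive_eq (is_derive_subf (is_derive_mulf (df _ za) dc)
    (is_derive_mulf (df' _ za) ds))).
  by ring.
have Bx : B x = f' 0.
  transitivity (B 0); last by rewrite /B c0 s0 mulr1 mulr0 addr0.
  apply: is_derive0_segment xa => z za; have dc := is_derive_osc_cos z l0.
  have ds := is_derive_osc_sin z l0.
  apply: (is_derive_eq (is_derive_addf (is_derive_mulf (df' _ za) dc)
    (is_derive_mulf (is_derive_scalef lam (df _ za)) ds))).
  by ring.
rewrite /y -Ax -Bx /A /B.
rewrite -[LHS]mulr1 -pyth; ring.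
Qed.

(** Regularity by bootstrap: [p] is continuous, so the integral against the Green function is twice
    differentiable in [x], and it equals [p] up to an affine function. *)
Lemma weak_oscillation (p : R -> R) lam a : 0 <= lam -> 0 < a ->
  continuous p ->
  (forall x, 0 <= x <= a ->
    p x - p 0 - x / a * (p a - p 0) =
    seg_int a (fun z => lam * p z * hat a x z)) ->
  exists y y', oscillation lam y y' /\ forall x, 0 <= x <= a -> p x = y x.
Proof.
move=> l0 a0 cp Hp.
have cq : continuous (fun z : R => z * p z).
  by move=> z; apply: cvgM; [exact: cvg_id|exact: cp].
have Ip b := continuous_seg_integrable b cp.
have Iq b := continuous_seg_integrable b cq.
have [P HP] := exists_antiderivative a0 cp.
have [Q HQ] := exists_antiderivative a0 cq.
(* Splitting the integral at the kink [z = x] expresses it through the antiderivatives [P] of [p]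
   and [Q] of [z * p z]. This gives [f], with [f'' = - lam p]; the terms linear in [x] with constant
   coefficient go into [A]. *)
pose M := seg_int a p; pose N := seg_int a (fun z => z * p z).
pose A := (p a - p 0) / a - lam * N / a.
pose f x := p 0 + x * A + lam * (x * M + (Q x - Q 0) - x * (P x - P 0)).
pose f' x := A + lam * (M - (P x - P 0)).
have pf x : 0 <= x <= a -> p x = f x.
  move=> xa; have := Hp x xa.
  have -> : (fun z => lam * p z * hat a x z) = (fun z => lam *
      (x * p z + (if z <= x then z * p z - x * p z else 0) -
       x / a * (z * p z))).
    by apply/funext => z; rewrite /hat; case: leP => _; ring.
  have Id : seg_integrable a
      (fun z => if z <= x then z * p z - x * p z else 0).
    apply: seg_integrable_truncate.
    apply: (@continuous_seg_integrable _ _ (fun z => z * p z - x * p z)) => z.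
    by apply: cvgB; [exact: cq|apply: cvgM; [exact: cvg_cst|exact: cp]].
  have Ixp b : seg_integrable b (fun z => x * p z) by exact: seg_integrableZ.
  rewrite seg_intZ; last first.
    apply: (@seg_integrableD _ _ (fun z => _ + _) (fun z => - _)).
      exact: seg_integrableD.
    under eq_fun do rewrite -mulNr.
    exact: seg_integrableZ.
  rewrite seg_intB; last 2 first.
  - exact: seg_integrableD.
  - exact: seg_integrableZ.
  rewrite seg_intD// seg_int_truncate seg_intB// !seg_intZ//.
  have -> : Num.min a x = x by rewrite min_r//; case/andP: xa.
  have [_ ->] := HP _ xa; have [_ ->] := HQ _ xa.
  rewrite -/M -/N /f /A => /eqP; rewrite -subr_eq0 => /eqP E.
  apply/eqP; rewrite -subr_eq0; apply/eqP; rewrite -[RHS]E.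
  by field; rewrite gt_eqF.
have dP x xa := (HP x xa).1; have dQ x xa := (HQ x xa).1.
have [x xa|x xa|y [y' [yy' E]]] :=
  @oscillation_extension lam a f f' l0 (ltW a0).
- have dx := is_derive_id x (1 : R).
  have dP' := is_derive_subf (dP _ xa) (is_derive_cst (P 0) x 1).
  have dQ' := is_derive_subf (dQ _ xa) (is_derive_cst (Q 0) x 1).
  have dp0 := is_derive_cst (p 0) x 1.
  have dxA := is_derive_mulf dx (is_derive_cst A x 1).
  have dxM := is_derive_mulf dx (is_derive_cst M x 1).
  have := is_derive_addf (is_derive_addf dp0 dxA) (is_derive_scalef lam
    (is_derive_subf (is_derive_addf dxM dQ') (is_derive_mulf dx dP'))).
  by move/is_derive_eq; apply; rewrite /f' /cst/=; ring.
- have dP' := is_derive_subf (dP _ xa) (is_derive_cst (P 0) x 1).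
  have := is_derive_addf (is_derive_cst A x 1) (is_derive_scalef lam
    (is_derive_subf (is_derive_cst M x 1) dP')).
  by move/is_derive_eq; apply; rewrite -pf//; ring.
by exists y, y'; split=> // x xa; rewrite -E// pf.
Qed.

End HarmonicOscillator.

(** * Eigenfunctions on a metric graph *)

Section EdgeOscillations.
Context {R : realType} {G : metric_graph R}.
Implicit Types (psi : gpoint G -> R) (lam : R) (y : edge G -> R -> R).
Implicit Types (e : edge G).

Lemma oscillation_continuous lam (y y' : R -> R) : oscillation lam y y' ->
  continuous y /\ continuous y'.
Proof.
by move=> yy'; split=> x; [exact: is_derive_continuous (yy' x).1|
  exact: is_derive_continuous (yy' x).2].
Qed.

Lemma continuousM_fun (f g : R -> R) : continuous f -> continuous g ->
  continuous (fun x => f x * g x).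
Proof. by move=> cf cg x; apply: cvgM; [exact: cf|exact: cg]. Qed.

(** [y e] continues [psi] smoothly beyond the ends of the edge, where the chart is constant. *)
Definition edge_oscillation psi lam y y' : Prop :=
  (forall e, oscillation lam (y e) (y' e)) /\
  (forall e x, 0 <= x <= len e -> psi (chart e x) = y e x).

(** The vertex conditions in weak form: minus the outward derivatives, weighted by [c]. An indicator
    [c] isolates one vertex, loops included, and the vertex values of a function give the boundary
    terms of an integration by parts. *)
Definition edge_kirchhoff y' : Prop := forall c : vertex G -> R,
  \sum_e (y' e (len e) * c (tgt e) - y' e 0 * c (src e)) = 0.

Lemma edge_oscillation_src psi lam y y' e :
  edge_oscillation psi lam y y' -> psi (vpt (src e)) = y e 0.
Proof.
case=> _ py; rewrite -py ?lexx ?ltW ?len_gt0//.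
by rewrite (@chart_le0 _ _ e 0).
Qed.

Lemma edge_oscillation_tgt psi lam y y' e :
  edge_oscillation psi lam y y' -> psi (vpt (tgt e)) = y e (len e).
Proof.
case=> _ py; rewrite -py ?lexx ?ltW ?len_gt0//.
by rewrite (@chart_ge_len _ _ e (len e)).
Qed.

Lemma innerE psi1 lam1 y1 y1' psi2 lam2 y2 y2' :
  edge_oscillation psi1 lam1 y1 y1' -> edge_oscillation psi2 lam2 y2 y2' ->
  inner psi1 psi2 = \sum_e seg_int (len e) (fun x => y1 e x * y2 e x).
Proof.
move=> [_ py1] [_ py2]; rewrite /inner /edge_int; apply: eq_bigr => e _.
by apply: eq_seg_int => x xe; rewrite py1// py2.
Qed.

(** Testing the equation against [psi] itself makes [lam] equal to the Dirichlet energy of [psi]. *)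
Lemma laplacian_eigenvalue_ge0 psi lam :
  laplacian psi (fun q => lam * psi q) -> inner psi psi = 1 -> 0 <= lam.
Proof.
move=> [_ [g [cpsi sg Hg] weak]] psi1.
have := weak _ _ (And3 cpsi sg Hg).
have -> : inner (fun q => lam * psi q) psi = lam.
  rewrite -[RHS]mulr1 -psi1 /inner /edge_int mulr_sumr.
  apply: eq_bigr => e _; rewrite -seg_intZ; last first.
    apply: continuous_seg_integrable.
    by apply: continuousM_fun; exact: (graph_continuousP psi).1.
  by apply: eq_seg_int => x _; rewrite mulrA.
move=> <-; apply: sumr_ge0 => e _; apply: seg_int_ge0 => x _.
by rewrite -expr2 sqr_ge0.
Qed.

Lemma laplacian_edge_oscillation psi lam :
  0 <= lam -> laplacian psi (fun q => lam * psi q) ->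
  exists y y', edge_oscillation psi lam y y' /\ edge_kirchhoff y'.
Proof.
move=> l0 [_ [g psiH1 weak]].
have cpsi e : continuous (psi \o chart e).
  by case: psiH1 => /graph_continuousP.
have He e := @weak_oscillation _ _ lam _ l0 (len_gt0 e) (cpsi e)
  (fun x => @weak_hat _ _ psi g lam psiH1 weak e x).
have [y Hy] := choice He; have [y' Hy'] := choice Hy.
have osc : edge_oscillation psi lam y y'.
  by split=> e; have [] := Hy' e.
exists y, y'; split=> // c.
have := weak_affine psiH1 weak c => /eqP.
rewrite -subr_eq0 -sumrB => /eqP E.
rewrite -[RHS]E; apply: eq_bigr => e _.
set a := len e; set d := (c (tgt e) - c (src e)) / a.
have a0 : 0 < a := len_gt0 e.
have oy := osc.1 e; have py := osc.2 e.
have [cy cy'] := oscillation_continuous oy.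
have -> : seg_int a (fun x => lam * psi (chart e x) * affine_on c e x) =
    seg_int a (fun x => lam * y e x * affine_on c e x).
  by apply: eq_seg_int => x xa; rewrite -py.
have da (x : R) : is_derive x 1 (affine_on c e) d.
  have := is_derive_addf (is_derive_cst (c (src e)) x (1 : R))
    (is_derive_scalef d (is_derive_id x (1 : R))).
  by move/is_derive_eq; apply; rewrite add0r mulr1.
have cF : continuous (fun x => lam * y e x * affine_on c e x).
  apply: continuousM_fun.
    by apply: continuousM_fun => //; exact: cst_continuous.
  by move=> x; exact: is_derive_continuous (da x).
(* The boundary values of this antiderivative contain [d] times the increment of [psi], which is the
   other side of [weak_affine]. After cancellation only the Kirchhoff sum remains. *)
have dF (x : R) : is_derive x 1 (fun x => d * y e x - y' e x * affine_on c e x)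
    (lam * y e x * affine_on c e x).
  have := is_derive_subf (is_derive_scalef d (oy x).1)
    (is_derive_mulf (oy x).2 (da x)).
  by move/is_derive_eq; apply; ring.
rewrite (seg_int_FTC2 a0 cF dF) affine_on0 affine_on_len !py ?lexx ?ltW//.
ring.
Qed.

(* Integration by parts; the boundary terms cancel by the Kirchhoff condition of
   the first function and the continuity of the second one. *)
Lemma edge_dirichlet_form psi1 lam1 y1 y1' psi2 lam2 y2 y2' :
  edge_oscillation psi1 lam1 y1 y1' -> edge_oscillation psi2 lam2 y2 y2' ->
  edge_kirchhoff y1' ->
  \sum_e seg_int (len e) (fun x => y1' e x * y2' e x) = lam1 * inner psi1 psi2.
Proof.
move=> o1 o2 k1; rewrite (innerE o1 o2).
have := k1 (fun v => psi2 (vpt v)) => E.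
rewrite -[LHS]subr0 -[X in _ - X]E mulr_sumr -sumrB; apply: eq_bigr => e _.
rewrite (edge_oscillation_src _ o2) (edge_oscillation_tgt _ o2).
case: o1 o2 => /(_ e) o1 _ [/(_ e) o2 _].
have [c1 c1'] := oscillation_continuous o1.
have [c2 c2'] := oscillation_continuous o2.
have c12 := continuousM_fun c1 c2; have c12' := continuousM_fun c1' c2'.
have cF : continuous (fun x => y1' e x * y2' e x - lam1 * (y1 e x * y2 e x)).
  move=> x; apply: cvgB; first exact: c12'.
  by apply: cvgM; [exact: cvg_cst|exact: c12].
have dF (x : R) : is_derive x 1 (fun x => y1' e x * y2 e x)
    (y1' e x * y2' e x - lam1 * (y1 e x * y2 e x)).
  have := is_derive_mulf (o1 x).2 (o2 x).1.
  by move/is_derive_eq; apply; ring.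
rewrite -(seg_int_FTC2 (len_gt0 e) cF dF) seg_intB ?seg_intZ.
- by rewrite opprB addrC subrK.
- exact: continuous_seg_integrable.
- exact: continuous_seg_integrable.
- exact/seg_integrableZ/continuous_seg_integrable.
Qed.

(** The constant energy times [len e] is its integral over the edge, which is at most [lam + lam] by
    the normalization of [psi] and [edge_dirichlet_form]. *)
Lemma edge_oscillation_bound psi lam y y' e x : 0 <= lam ->
  edge_oscillation psi lam y y' -> edge_kirchhoff y' -> inner psi psi = 1 ->
  y e x ^+ 2 <= 2 / len e /\ y' e x ^+ 2 <= 2 / len e * lam.
Proof.
move=> l0 o k psi1; set a := len e.
have a0 : 0 < a := len_gt0 e.
have [oe _] := o; have [cy cy'] := oscillation_continuous (oe e).
have sqr_cont (f : R -> R) : continuous f -> continuous (fun x => f x ^+ 2).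
  by move=> cf; under eq_fun do rewrite expr2; exact: continuousM_fun.
have cy2 := sqr_cont _ cy; have cy2' := sqr_cont _ cy'.
have S1 : seg_int a (fun x => y e x ^+ 2) <= 1.
  rewrite -psi1 (innerE o o) (bigD1 e)//= lerDl.
  by apply: sumr_ge0 => i _; apply: seg_int_ge0 => z _; rewrite -expr2 sqr_ge0.
have S2 : seg_int a (fun x => y' e x ^+ 2) <= lam.
  rewrite -[leRHS]mulr1 -psi1 -(edge_dirichlet_form o o k) (bigD1 e)//= lerDl.
  by apply: sumr_ge0 => i _; apply: seg_int_ge0 => z _; rewrite -expr2 sqr_ge0.
pose E z := y' e z ^+ 2 + lam * y e z ^+ 2.
have Ecst z : E z = E x.
  apply: is_derive_0_is_cst => {}z; rewrite /E.
  under eq_fun do rewrite !expr2.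
  have [d1 d2] := oe e z.
  have := is_derive_addf (is_derive_mulf d2 d2)
    (is_derive_scalef lam (is_derive_mulf d1 d1)).
  by move/is_derive_eq; apply; ring.
have EI : a * E x <= 2 * lam.
  rewrite mulrC -(seg_int_cst (E x) (ltW a0)).
  have -> : (fun=> E x) = E by apply/funext => z; rewrite Ecst.
  rewrite /E seg_intD ?seg_intZ; last 3 first.
  - exact: continuous_seg_integrable.
  - exact: continuous_seg_integrable.
  - exact/seg_integrableZ/continuous_seg_integrable.
  by rewrite mulr2n mulrDl !mul1r lerD// -[leRHS]mulr1 ler_wpM2l.
have Ey' : y' e x ^+ 2 <= E x by rewrite /E lerDl mulr_ge0 ?sqr_ge0.
have Ey : lam * y e x ^+ 2 <= E x by rewrite /E lerDr sqr_ge0.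
have y'le : y' e x ^+ 2 <= 2 / a * lam.
  apply: le_trans Ey' _; rewrite mulrAC ler_pdivlMr// mulrC//.
(* The bound on [y] comes from dividing the energy by [lam]. When [lam = 0], the energy bound forces
   [y' = 0], and the constant [y] is controlled by its L^2 norm. *)
split=> //; have [l0'|lpos] := leP lam 0; last first.
  rewrite -(ler_pM2l lpos); apply: le_trans Ey _.
  by rewrite mulrC mulrAC ler_pdivlMr// mulrC.
have lam0 : lam = 0 by apply/eqP; rewrite eq_le l0' l0.
have dy (z : R) : is_derive z 1 (y e) 0.
  have [d1 _] := oe e z; apply: (is_derive_eq d1).
  apply/eqP; rewrite -sqrf_eq0 eq_le sqr_ge0 andbT.
  have := Ecst z; rewrite /E lam0 !mul0r !addr0 => ->.
  by move: y'le; rewrite lam0 mulr0.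
have ycst z : y e z = y e x by exact: is_derive_0_is_cst dy.
move: S1; under eq_fun do rewrite ycst.
rewrite (seg_int_cst _ (ltW a0)) => S1; rewrite ler_pdivlMr// (le_trans S1)//.
by rewrite ler1n.
Qed.

End EdgeOscillations.

(** * Trace of the resolvent *)

Lemma le_derive_segment {R : realType} (f f' : R -> R) (a b : R) : a <= b ->
  (forall z, a <= z <= b -> is_derive z 1 f (f' z)) ->
  (forall z, a <= z <= b -> 0 <= f' z) -> f a <= f b.
Proof.
move=> ab df f'0.
have dfo z : z \in `]a, b[ -> is_derive z 1 f (f' z).
  by move=> /subset_itv_oo_cc; rewrite in_itv => /df.
have cf : {within `[a, b], continuous f}.
  by apply: derivable_within_continuous => z; rewrite in_itv/= => /df[].
have [c] := MVT_segment ab dfo cf.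
rewrite in_itv/= => cab E; rewrite -subr_ge0 E mulr_ge0 ?subr_ge0//.
exact: f'0.
Qed.

(* With W an antiderivative of u^2 + u'^2, the functions (1 + a) W - z u^2 and
   (1 + a) W + (a - z) u^2 are nondecreasing on [0, a]; add the resulting bounds
   on [0, x] and [x, a]. *)
Lemma sobolev_segment {R : realType} (u u' : R -> R) (a x : R) : 0 < a ->
  (forall z : R, is_derive z 1 u (u' z)) -> continuous u' -> 0 <= x <= a ->
  a * u x ^+ 2 <= (1 + a) * seg_int a (fun z => u z ^+ 2 + u' z ^+ 2).
Proof.
move=> a0 du cu' /andP[x0 xa].
have cu : continuous u by move=> z; exact: is_derive_continuous (du z).
have cw : continuous (fun z => u z ^+ 2 + u' z ^+ 2).
  under eq_fun do rewrite !expr2.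
  by move=> z; apply: cvgD; [exact: continuousM_fun|exact: continuousM_fun].
have [W HW] := exists_antiderivative a0 cw.
have a_a : 0 <= a <= a by rewrite lexx ltW.
have [_ ->] := HW _ a_a.
have w0 z : 0 <= u z ^+ 2 + u' z ^+ 2 by rewrite addr_ge0 ?sqr_ge0.
have h1 (z : R) : 2 * (u z * u' z) <= u z ^+ 2 + u' z ^+ 2.
  by have := sqr_ge0 (u z - u' z); rewrite !expr2; lra.
have h2 z : - (2 * (u z * u' z)) <= u z ^+ 2 + u' z ^+ 2.
  by have := sqr_ge0 (u z + u' z); rewrite !expr2; lra.
have dW (z : R) : 0 <= z <= a ->
    is_derive z 1 (fun z => (1 + a) * W z)
      ((1 + a) * (u z ^+ 2 + u' z ^+ 2)).
  by move=> /HW[dW _]; exact: is_derive_scalef.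
have du2 (z : R) : is_derive z 1 (fun z => u z * u z) (u z * u' z + u z * u' z).
  exact: is_derive_mulf.
have L : (1 + a) * W 0 - 0 * (u 0 * u 0) <= (1 + a) * W x - x * (u x * u x).
  apply: (@le_derive_segment _ (fun z => (1 + a) * W z - z * (u z * u z))
    (fun z => (1 + a) * (u z ^+ 2 + u' z ^+ 2) -
      (z * (u z * u' z + u z * u' z) + (u z * u z) * 1))) => //.
    move=> z /andP[z0 zx].
    apply: is_derive_subf; first by apply: dW; rewrite z0 (le_trans zx).
    exact: is_derive_mulf.
  move=> z /andP[z0 zx]; have za := le_trans zx xa.
  have H : z * (2 * (u z * u' z)) <= a * (u z ^+ 2 + u' z ^+ 2).
    exact: le_trans (ler_wpM2l z0 (h1 z)) (ler_wpM2r (w0 z) za).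
  by have := sqr_ge0 (u' z); move: H; rewrite !expr2; lra.
have U : (1 + a) * W x + (a - x) * (u x * u x) <=
    (1 + a) * W a + (a - a) * (u a * u a).
  apply: (@le_derive_segment _ (fun z => (1 + a) * W z + (a - z) * (u z * u z))
    (fun z => (1 + a) * (u z ^+ 2 + u' z ^+ 2) +
      ((a - z) * (u z * u' z + u z * u' z) + (u z * u z) * (0 - 1)))) => //.
    move=> z /andP[xz za].
    apply: is_derive_addf; first by apply: dW; rewrite za (le_trans x0).
    by apply: is_derive_mulf => //; exact: is_derive_subf.
  move=> z /andP[xz za]; have z0 := le_trans x0 xz.
  have az0 : 0 <= a - z by rewrite subr_ge0.
  have aza : a - z <= a by rewrite gerBl.
  have H : (a - z) * - (2 * (u z * u' z)) <= a * (u z ^+ 2 + u' z ^+ 2).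
    exact: le_trans (ler_wpM2l az0 (h2 z)) (ler_wpM2r (w0 z) aza).
  by have := sqr_ge0 (u' z); move: H; rewrite !expr2; lra.
by move: L U; rewrite expr2; lra.
Qed.

Section ResolventTrace.
Context {R : realType} {G : metric_graph R}.
Variables (lam : nat -> R) (psi : nat -> gpoint G -> R).
Variables y y' : nat -> edge G -> R -> R.
Hypothesis lam_ge0 : forall j, 0 <= lam j.
Hypothesis psi_orthonormal : forall i j, inner (psi i) (psi j) = (i == j)%:R.
Hypothesis psi_osc : forall j, edge_oscillation (psi j) (lam j) (y j) (y' j).
Hypothesis psi_kirchhoff : forall j, edge_kirchhoff (y' j).

Let lam1_gt0 j : 0 < 1 + lam j.
Proof. by rewrite ltr_wpDr. Qed.

Let y_continuous j e : continuous (y j e).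
Proof. by case: (oscillation_continuous ((psi_osc j).1 e)). Qed.

Let y'_continuous j e : continuous (y' j e).
Proof. by case: (oscillation_continuous ((psi_osc j).1 e)). Qed.

(** By [edge_dirichlet_form] the [psi j] are orthogonal in H^1 too, with squared norm [1 + lam j].
    The cross terms cancel only after summation over the edges, hence the exchange of sums. *)
Lemma H1_norm_combination (n : nat) (c : 'I_n -> R) :
  \sum_e seg_int (len e) (fun z => (\sum_j c j * y j e z) ^+ 2 +
                                   (\sum_j c j * y' j e z) ^+ 2) =
  \sum_j c j ^+ 2 * (1 + lam j).
Proof.
have E e : seg_int (len e) (fun z => (\sum_j c j * y j e z) ^+ 2 +
                                     (\sum_j c j * y' j e z) ^+ 2) =
  \sum_i \sum_j (c i * c j) *
     (seg_int (len e) (fun z => y i e z * y j e z) +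
      seg_int (len e) (fun z => y' i e z * y' j e z)).
  have Iy (i j : 'I_n) : seg_integrable (len e) (fun z => y i e z * y j e z).
    exact/continuous_seg_integrable/continuousM_fun.
  have Iy' (i j : 'I_n) :
      seg_integrable (len e) (fun z => y' i e z * y' j e z).
    exact/continuous_seg_integrable/continuousM_fun.
  have Iyy (i j : 'I_n) : seg_integrable (len e) (fun z => (c i * c j) *
      (y i e z * y j e z + y' i e z * y' j e z)).
    exact/seg_integrableZ/seg_integrableD.
  rewrite (@eq_seg_int _ _ _ (fun z => \sum_(i < n) \sum_(j < n) (c i * c j) *
      (y i e z * y j e z + y' i e z * y' j e z))).
    rewrite seg_int_sum; last by move=> i; exact: seg_integrable_sum.
    apply: eq_bigr => i _; rewrite seg_int_sum//; apply: eq_bigr => j _.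
    by rewrite seg_intZ ?seg_intD//; exact: seg_integrableD.
  move=> z _; rewrite !expr2 !big_distrlr/= -big_split/=.
  apply: eq_bigr => i _; rewrite -big_split/=; apply: eq_bigr => j _.
  ring.
under eq_bigr do rewrite E.
rewrite exchange_big/=; apply: eq_bigr => i _.
rewrite exchange_big/= (bigD1 i)//= [X in _ + X]big1 ?addr0; last first.
  move=> j ji; rewrite -mulr_sumr big_split/=.
  rewrite -(innerE (psi_osc i) (psi_osc j)).
  rewrite (edge_dirichlet_form (psi_osc i) (psi_osc j))//.
  by rewrite psi_orthonormal eq_sym val_eqE (negPf ji) mulr0 addr0 mulr0.
rewrite -mulr_sumr big_split/= -(innerE (psi_osc i) (psi_osc i)).
rewrite (edge_dirichlet_form (psi_osc i) (psi_osc i))//.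
by rewrite psi_orthonormal eqxx mulr1 expr2.
Qed.

(* The sum S is the diagonal of the (truncated) resolvent kernel.  The function
   u := \sum_j c_j psi_j with c_j := psi_j(x) / (1 + lam_j) satisfies
   u(x) = S and has squared H^1 norm S, so Sobolev's inequality bounds S^2 by a
   multiple of S. *)
Lemma resolvent_diagonal_bound (n : nat) e (x : R) : 0 <= x <= len e ->
  len e * (\sum_(j < n) (1 + lam j)^-1 * y j e x ^+ 2) <= 1 + len e.
Proof.
move=> xe; set S := \sum_(j < n) _.
have a0 := len_gt0 e.
pose c (j : 'I_n) := y j e x / (1 + lam j).
pose u e z := \sum_j c j * y j e z; pose u' e z := \sum_j c j * y' j e z.
have S0 : 0 <= S.
  by apply: sumr_ge0 => j _; rewrite mulr_ge0 ?sqr_ge0// invr_ge0 ltW.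
have ux : u e x = S by apply: eq_bigr => j _; rewrite /c; ring.
have du (z : R) : is_derive z 1 (u e) (u' e z).
  have -> : u e = \sum_j (fun z => c j * y j e z).
    by apply/funext => w; rewrite fct_sumE.
  apply: is_derive_sum => j.
  by apply: is_derive_scalef; case: (psi_osc j) => /(_ e z)[].
have cu' e' : continuous (u' e').
  move=> z; have -> : u' e' = \sum_j (fun z => c j * y' j e' z).
    by apply/funext => w; rewrite fct_sumE.
  apply: is_derive_continuous; apply: is_derive_sum => j.
  by apply: is_derive_scalef; case: (psi_osc j) => /(_ e' z)[].
have := sobolev_segment a0 du (cu' e) xe.
rewrite ux => H.
have {}H : len e * S ^+ 2 <= (1 + len e) * S.
  have a1 : 0 <= 1 + len e by rewrite addr_ge0// ltW.
  apply: le_trans H _; apply: (ler_wpM2l a1).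
  have <- : \sum_j c j ^+ 2 * (1 + lam j) = S.
    apply: eq_bigr => j _; rewrite /c; field; rewrite gt_eqF//.
  rewrite -H1_norm_combination (bigD1 e)//= lerDl.
  apply: sumr_ge0 => e' _; apply: seg_int_ge0 => z _.
  by rewrite addr_ge0 ?sqr_ge0.
have [S0'|Spos] := leP S 0.
  have -> : S = 0 by apply/eqP; rewrite eq_le S0 S0'.
  by rewrite mulr0 addr_ge0// ltW.
by rewrite -(ler_pM2r Spos) -mulrA -expr2.
Qed.

(** Integrating the diagonal of the truncated resolvent kernel over the graph gives its trace, since
    each [psi j] has norm 1; the diagonal bound is uniform in the truncation. *)
Lemma resolvent_trace_cvg : cvgn (series (fun j => (1 + lam j)^-1)).
Proof.
apply: nondecreasing_is_cvgn.
  apply: nondecreasing_series => j _ _.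
  by rewrite invr_ge0 ltW.
exists (\sum_(e : edge G) (1 + len e)) => _ [n _ <-].
rewrite /series/= big_mkord.
have E : \sum_(j < n) (1 + lam j)^-1 =
    \sum_e seg_int (len e)
      (fun x => \sum_(j < n) (1 + lam j)^-1 * y j e x ^+ 2).
  have cy2 (j : 'I_n) e : continuous (fun x => y j e x ^+ 2).
    by under eq_fun do rewrite expr2; exact: continuousM_fun.
  under [RHS]eq_bigr => e _.
    rewrite seg_int_sum; last first.
      by move=> j; exact/seg_integrableZ/continuous_seg_integrable.
    under eq_bigr => j _ do
      rewrite (seg_intZ _ (continuous_seg_integrable _ (cy2 j e))).
    over.
  rewrite exchange_big/=; apply: eq_bigr => j _; rewrite -mulr_sumr.
  rewrite -[LHS]mulr1; congr (_ * _).
  have <- : inner (psi j) (psi j) = 1 by rewrite psi_orthonormal eqxx.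
  exact: innerE (psi_osc j) (psi_osc j).
rewrite E; apply: ler_sum => e _.
have a0 := len_gt0 e.
have -> : 1 + len e = seg_int (len e) (fun=> (1 + len e) / len e).
  by rewrite (seg_int_cst _ (ltW a0)) divfK// gt_eqF.
apply: le_seg_int => [||x xe].
- apply: seg_integrable_sum => j.
  apply/seg_integrableZ/continuous_seg_integrable.
  by under eq_fun do rewrite expr2; exact: continuousM_fun.
- exact: seg_integrable_cst.
by rewrite ler_pdivlMr// mulrC; exact: resolvent_diagonal_bound.
Qed.

End ResolventTrace.

(** * Series weighted by the heat semigroup *)

Section HeatSeries.
Context {R : realType}.
Variable lam : nat -> R.
Hypothesis lam_ge0 : forall j, 0 <= lam j.
Hypothesis trace_cvg : cvgn (series (fun j => (1 + lam j)^-1)).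

Let lam1_gt0 j : 0 < 1 + lam j.
Proof. by rewrite ltr_wpDr. Qed.

Definition heat_sum (t : R) (f : nat -> R) : R :=
  limn (series (fun j => expR (- t * lam j) * f j)).

(** The exponential absorbs four powers of [1 + lam j]: three offset the growth of [f], and the
    fourth leaves the summable factor [(1 + lam j)^-1]. *)
Lemma heat_sum_cvg (t C : R) (f : nat -> R) : 0 < t ->
  (forall j, `|f j| <= C * (1 + lam j) ^+ 3) ->
  cvgn (series (fun j => expR (- t * lam j) * f j)).
Proof.
move=> t0 fC; pose K := expR t * (4 / t) ^+ 4.
apply: (@cvg_series_dominated _ _ (fun j => C * K * (1 + lam j)^-1));
  last exact: (is_cvg_seriesZ trace_cvg).
move=> j; have C0 : 0 <= C.
  have := le_trans (normr_ge0 _) (fC j).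
  by rewrite pmulr_lge0// exprn_gt0.
rewrite normrM ger0_norm ?expR_ge0//.
apply: le_trans (ler_wpM2l (expR_ge0 _) (fC j)) _.
rewrite ler_pdivlMr//.
have -> : expR (- t * lam j) * (C * (1 + lam j) ^+ 3) * (1 + lam j) =
  C * (expR (- t * lam j) * (1 + lam j) ^+ 4) by ring.
by rewrite ler_wpM2l//; exact: expR_poly4_bound.
Qed.

Lemma heat_sum_quad_approx (t C x : R) (f f' f'' : nat -> R -> R) : 0 < t ->
  (forall j (z : R), is_derive z 1 (f j) (f' j z)) ->
  (forall j (z : R), is_derive z 1 (f' j) (f'' j z)) ->
  (forall j z, `|f j z| <= C * (1 + lam j) ^+ 3) ->
  (forall j z, `|f' j z| <= C * (1 + lam j) ^+ 3) ->
  (forall j z, `|f'' j z| <= C * (1 + lam j) ^+ 3) ->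
  quad_approx (fun z => heat_sum t (f ^~ z)) x (heat_sum t (f' ^~ x)).
Proof.
move=> t0 df df' bf bf' bf''.
have d1 j z (_ : `|z - x| < 1) : is_derive z 1
    (fun z => expR (- t * lam j) * f j z) (expR (- t * lam j) * f' j z).
  exact: is_derive_scalef (df j z).
have d2 j z (_ : `|z - x| < 1) : is_derive z 1
    (fun z => expR (- t * lam j) * f' j z) (expR (- t * lam j) * f'' j z).
  exact: is_derive_scalef (df' j z).
apply: (quad_approx_series
  (M := fun j => expR (- t * lam j) * (C * (1 + lam j) ^+ 3)) ltr01 d1 d2).
- by move=> j z _; rewrite normrM ger0_norm ?expR_ge0// ler_wpM2l ?expR_ge0.
- apply: (@heat_sum_cvg t C) => // j; rewrite ger0_norm//.
  exact: le_trans (normr_ge0 _) (bf j x).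
- by move=> z _; exact: (heat_sum_cvg t0 (bf ^~ z)).
- exact: (heat_sum_cvg t0 (bf' ^~ x)).
Qed.

(** The quadratic error involves two time derivatives, each costing a factor [lam j], so linear
    growth of [c] fits the cubic growth allowed by [heat_sum_cvg]. In the ball of radius [t / 2] all
    exponentials are below those at time [t / 2]. *)
Lemma heat_sum_is_derive_time (t C : R) (c : nat -> R) : 0 < t ->
  (forall j, `|c j| <= C * (1 + lam j)) ->
  is_derive t 1 (heat_sum ^~ c) (heat_sum t (fun j => - lam j * c j)).
Proof.
move=> t0 bc; apply: quad_approx_is_derive.
have t20 : 0 < t / 2 by rewrite divr_gt0.
have C0 : 0 <= C.
  by have := le_trans (normr_ge0 _) (bc 0%N); rewrite pmulr_lge0.
have bk k j : (k <= 2)%N -> `|lam j ^+ k * c j| <= C * (1 + lam j) ^+ 3.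
  move=> k2; rewrite normrM ger0_norm ?exprn_ge0//.
  have L1 : 1 <= 1 + lam j by rewrite lerDl.
  have h1 : lam j ^+ k <= (1 + lam j) ^+ 2.
    apply: le_trans (ler_weXn2l L1 k2).
    by rewrite lerXn2r ?nnegrE// ?lerDr// addr_ge0.
  have -> : C * (1 + lam j) ^+ 3 = (1 + lam j) ^+ 2 * (C * (1 + lam j)).
    by ring.
  by apply: ler_pM => //; exact: exprn_ge0.
have near_gt0 (z : R) : `|z - t| < t / 2 -> t / 2 <= z.
  by rewrite ltr_norml => /andP[h _]; lra.
have de j (s a : R) : is_derive s 1 (fun s => expR (- s * lam j) * a)
    (expR (- s * lam j) * (- lam j * a)).
  have -> : (fun s => expR (- s * lam j) * a) =
      (fun s => a * expR (- lam j * s)).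
    by apply/funext => r; rewrite mulrC !mulNr (mulrC r).
  have := is_derive_scalef a
    (is_derive_scale_arg (is_derive_expR (- lam j * s))).
  move/is_derive_eq; apply.
  have -> : - lam j * s = - s * lam j by ring.
  ring.
apply: (@quad_approx_series _ (fun j s => expR (- s * lam j) * c j)
  (fun j s => expR (- s * lam j) * (- lam j * c j))
  (fun j s => expR (- s * lam j) * (lam j ^+ 2 * c j))
  (fun j => expR (- (t / 2) * lam j) * (C * (1 + lam j) ^+ 3)) t (t / 2)) => //.
- move=> j z _; have := de j z (- lam j * c j).
  by move/is_derive_eq; apply; ring.
- move=> j z /near_gt0 zt; rewrite normrM ger0_norm ?expR_ge0//.
  apply: ler_pM; rewrite ?expR_ge0//; last exact: (bk 2%N).
  by rewrite ler_expR !mulNr lerN2 ler_wpM2r.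
- apply: (@heat_sum_cvg (t / 2) C) => // j; rewrite ger0_norm//.
  by rewrite mulr_ge0// exprn_ge0// ltW.
- move=> z /near_gt0 zt; apply: (@heat_sum_cvg z C).
    exact: lt_le_trans zt.
  by move=> j; have := bk 0%N j isT; rewrite expr0 mul1r.
- apply: (@heat_sum_cvg t C) => // j.
  by have := bk 1%N j isT; rewrite expr1 mulNr normrN.
Qed.

End HeatSeries.

(** * The diagonal of the heat kernel *)

Lemma quad_approx_reflect {R : realType} (f : R -> R) (a l : R) :
  quad_approx f a l -> quad_approx (fun s => f (a - s)) 0 (- l).
Proof.
move=> [K [r [r0 H]]]; exists K, r; split=> // z; rewrite subr0 => zr.
have := H (a - z).
have -> : a - z - a = - z by ring.
by rewrite normrN subr0 sqrrN mulrN mulNr => /(_ zr).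
Qed.

Lemma quad_approx_outward {R : realType} {G : metric_graph R}
    (u : gpoint G -> R) (d : edge G * bool) (f : R -> R) (l : R) :
  (forall s, 0 <= s <= len d.1 -> u (end_chart d s) = f s) ->
  quad_approx f 0 l -> outward_derivative u d l.
Proof.
move=> uf [K [r [r0 H]]].
apply: (@cvg_linear_error _ _ _ _ (fun s => s) _ K); last first.
  by apply: cvg_within_filter; exact: cvg_id.
near=> s.
have s0 : 0 < s by near: s; exact: nbhs_right_gt.
have sl : s < len d.1 by near: s; apply: nbhs_right_lt; exact: len_gt0.
have sr : s < r by near: s; exact: nbhs_right_lt.
rewrite !uf ?lexx ?(ltW s0) ?(ltW sl) ?(ltW (len_gt0 _))//.
have := @quad_approx_quotient _ f 0 l K s.
rewrite !subr0; apply; first by rewrite gt_eqF.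
by have := H s; rewrite !subr0; apply; rewrite gtr0_norm.
Unshelve. all: by end_near. Qed.

Section HeatDiagonal.
Context {R : realType} {G : metric_graph R}.
Variables (lam : nat -> R) (psi : nat -> gpoint G -> R).
Variables y y' : nat -> edge G -> R -> R.
Hypothesis lam_ge0 : forall j, 0 <= lam j.
Hypothesis psi_orthonormal : forall i j, inner (psi i) (psi j) = (i == j)%:R.
Hypothesis psi_osc : forall j, edge_oscillation (psi j) (lam j) (y j) (y' j).
Hypothesis psi_kirchhoff : forall j, edge_kirchhoff (y' j).
Implicit Types (e : edge G) (t x z : R).

Let trace_cvg : cvgn (series (fun j => (1 + lam j)^-1)).
Proof. exact: resolvent_trace_cvg psi_orthonormal psi_osc psi_kirchhoff. Qed.

(* Junk for k > 4: only the first four derivatives of psi_j^2 are used. *)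
Definition sqr_deriv (k : nat) (e : edge G) (j : nat) (x : R) : R :=
  match k with
  | 0 => y j e x * y j e x
  | 1 => 2 * (y j e x * y' j e x)
  | 2 => 2 * (y' j e x * y' j e x) - 2 * lam j * (y j e x * y j e x)
  | 3 => - (8 * lam j) * (y j e x * y' j e x)
  | _ => - (8 * lam j) * (y' j e x * y' j e x) +
         8 * lam j * lam j * (y j e x * y j e x)
  end.

Lemma is_derive_sqr_deriv k e j (x : R) : (k < 4)%N ->
  is_derive x 1 (sqr_deriv k e j) (sqr_deriv k.+1 e j x).
Proof.
have [d1 d2] := (psi_osc j).1 e x.
have dyy := is_derive_mulf d1 d1; have dyy' := is_derive_mulf d1 d2.
have dy'y' := is_derive_mulf d2 d2.
case: k => [|[|[|[|k]]]] k4 /=; last by [].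

- by apply: (is_derive_eq dyy); ring.
- by apply: (is_derive_eq (is_derive_scalef 2 dyy')); ring.
- apply: (is_derive_eq (is_derive_subf (is_derive_scalef 2 dy'y')
    (is_derive_scalef (2 * lam j) dyy))); ring.
- by apply: (is_derive_eq (is_derive_scalef (- (8 * lam j)) dyy')); ring.
Qed.

Let D e : R := 2 / len e.

Let D_ge0 e : 0 <= D e.
Proof. by rewrite divr_ge0// ltW ?len_gt0. Qed.

Let psi_normal j : inner (psi j) (psi j) = 1.
Proof. by rewrite psi_orthonormal eqxx. Qed.

(** From [2 |y y'| <= y^2 + y'^2]. Differentiation in time requires this linear growth in
    [lam j]. *)
Lemma sqr_deriv1_bound e j x : `|sqr_deriv 1 e j x| <= D e * (1 + lam j).
Proof.
have [b1 b2] := edge_oscillation_bound e x (lam_ge0 j) (psi_osc j)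
  (psi_kirchhoff j) (psi_normal j).
rewrite -/(D e) in b1 b2.
have := sqr_ge0 (y j e x - y' j e x); have := sqr_ge0 (y j e x + y' j e x).
rewrite ler_norml /= mulrDr mulr1; move: b1 b2; rewrite !expr2 => b1 b2 h1 h2.
by apply/andP; split; lra.
Qed.

(** The crude constant 16 comes from the last case, where each of the two terms is at most
    [8 * D e * lam j ^+ 2]. *)
Lemma sqr_deriv_bound k e j x :
  `|sqr_deriv k e j x| <= 16 * D e * (1 + lam j) ^+ 3.
Proof.
have [b1 b2] := edge_oscillation_bound e x (lam_ge0 j) (psi_osc j)
  (psi_kirchhoff j) (psi_normal j).
rewrite -/(D e) in b1 b2.
have L0 := lam_ge0 j; have D0 := D_ge0 e.
set L := lam j in L0 b2 *; set d := D e in b1 b2 D0 *.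
have L2 : 0 <= L * L by rewrite mulr_ge0.
have L3 : 0 <= L * L * L by rewrite mulr_ge0.
have dL := mulr_ge0 D0 L0; have dL2 := mulr_ge0 D0 L2.
have dL3 := mulr_ge0 D0 L3.
(* The cube is expanded into monomials and the needed products of inequalities are supplied, so that
   each case is linear for [lra]. *)
have -> : 16 * d * (1 + L) ^+ 3 =
  16 * d + 48 * (d * L) + 48 * (d * (L * L)) + 16 * (d * (L * L * L)) by ring.
set p := y j e x in b1 *; set q := y' j e x in b2 *.
have p2 : 0 <= p * p by rewrite -expr2 sqr_ge0.
have q2 : 0 <= q * q by rewrite -expr2 sqr_ge0.
have pq1 : 0 <= (p - q) ^+ 2 := sqr_ge0 _.
have pq2 : 0 <= (p + q) ^+ 2 := sqr_ge0 _.
have Lpq1 := mulr_ge0 L0 pq1; have Lpq2 := mulr_ge0 L0 pq2.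
have Lb1 := ler_wpM2l L0 b1; have Lb2 := ler_wpM2l L0 b2.
have LLb1 := ler_wpM2l L2 b1.
have Lp2 := mulr_ge0 L0 p2; have Lq2 := mulr_ge0 L0 q2.
have LLp2 := mulr_ge0 L2 p2.
rewrite !expr2 in b1 b2 pq1 pq2 Lpq1 Lpq2 Lb1 Lb2 LLb1.
rewrite ler_norml; apply/andP.
case: k => [|[|[|[|k]]]] /=; rewrite -/p -/q -/L; split; lra.
Qed.

(** The [k]-th space derivative of the heat diagonal on the edge for [k <= 3], continued smoothly
    beyond its ends. *)
Definition heat_diag (k : nat) (e : edge G) (t x : R) : R :=
  heat_sum lam t (sqr_deriv k e ^~ x).

(** The error term uses the derivative of order [k + 2], which must be among the first four. *)
Lemma heat_diag_quad_approx k e t x : (k < 3)%N -> 0 < t ->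
  quad_approx (heat_diag k e t) x (heat_diag k.+1 e t x).
Proof.
move=> k3 t0.
have d1 j (z : R) : is_derive z 1 (sqr_deriv k e j) (sqr_deriv k.+1 e j z).
  by apply: is_derive_sqr_deriv; rewrite ltnW.
have d2 j (z : R) : is_derive z 1 (sqr_deriv k.+1 e j) (sqr_deriv k.+2 e j z).
  exact: is_derive_sqr_deriv.
exact: (heat_sum_quad_approx lam_ge0 trace_cvg x t0 d1 d2
  (sqr_deriv_bound k e) (sqr_deriv_bound k.+1 e) (sqr_deriv_bound k.+2 e)).
Qed.

Lemma heat_diag_continuous e t : 0 < t -> continuous (heat_diag 0 e t).
Proof.
move=> t0 x; apply: is_derive_continuous.
exact: (quad_approx_is_derive (heat_diag_quad_approx e x (isT : 0 < 3)%N t0)).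
Qed.

(** Termwise, [- lam * (2 y y')] is a quarter of [- 8 lam y y'], the third derivative of [y^2]. *)
Lemma heat_diag_is_derive_time e t x : 0 < t ->
  is_derive t 1 (heat_diag 1 e ^~ x) (1 / 4 * heat_diag 3 e t x).
Proof.
move=> t0.
apply: (is_derive_eq (heat_sum_is_derive_time lam_ge0 trace_cvg t0
  (fun j => sqr_deriv1_bound e j x))).
have cv := heat_sum_cvg lam_ge0 trace_cvg t0 (fun j => sqr_deriv_bound 3 e j x).
rewrite /heat_diag /heat_sum -[RHS](lim_seriesZ _ cv).
congr (lim (series _ @ \oo)); apply/funext => j.
by rewrite /GRing.scale/= /GRing.scale/=; field.
Qed.

Lemma heat_diag_kirchhoff t v : 0 < t ->
  \sum_e (heat_diag 1 e t (len e) * (tgt e == v)%:R -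
          heat_diag 1 e t 0 * (src e == v)%:R) = 0.
Proof.
move=> t0.
pose S e x := series (fun j => expR (- t * lam j) * sqr_deriv 1 e j x).
have cS e x : S e x @ \oo --> heat_diag 1 e t x.
  exact: (heat_sum_cvg lam_ge0 trace_cvg t0 (fun j => sqr_deriv_bound 1 e j x)).
have cvS : (fun n => \sum_e (S e (len e) n * (tgt e == v)%:R -
      S e 0 n * (src e == v)%:R)) @ \oo -->
    \sum_e (heat_diag 1 e t (len e) * (tgt e == v)%:R -
            heat_diag 1 e t 0 * (src e == v)%:R).
  apply: cvg_big => [|e _]; first exact: add_continuous.
  by apply: cvgB; apply: cvgM => //; exact: cvg_cst.
apply: cvg_unique cvS _ => //.
(* Already every partial sum satisfies the vertex condition. *)
apply: cvg_near_cst; apply: nearW => n.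
rewrite /S /series/=.
transitivity (\sum_(0 <= j < n) expR (- t * lam j) * 2 *
   \sum_e (y' j e (len e) * (psi j (vpt (tgt e)) * (tgt e == v)%:R) -
           y' j e 0 * (psi j (vpt (src e)) * (src e == v)%:R))).
  under [RHS]eq_bigr do rewrite mulr_sumr.
  rewrite [RHS]exchange_big/=; apply: eq_bigr => e _.
  rewrite !mulr_suml -sumrB; apply: eq_bigr => j _.
  rewrite (edge_oscillation_src _ (psi_osc j)).
  rewrite (edge_oscillation_tgt _ (psi_osc j)).
  ring.
apply: big1 => j _.
(* Continuity of [psi j] makes the factor [psi j] in [2 psi psi'] a vertex weight, which is absorbed
   into the test vector. *)
have := psi_kirchhoff j (fun w => psi j (vpt w) * (w == v)%:R).
by move=> /= ->; rewrite mulr0.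
Qed.

Variable H : R -> gpoint G -> gpoint G -> R.
Hypothesis HE : forall t q1 q2, 0 < t -> H t q1 q2 =
  limn (series (fun j => expR (- t * lam j) * psi j q1 * psi j q2)).

Lemma heat_kernel_diagE e t x : 0 < t -> 0 <= x <= len e ->
  H t (chart e x) (chart e x) = heat_diag 0 e t x.
Proof.
move=> t0 xe; rewrite HE//; congr (lim (series _ @ \oo)); apply/funext => j.
by rewrite (psi_osc j).2//= mulrA.
Qed.

Lemma heat_kernel_diag_continuous t : 0 < t -> continuous (fun q => H t q q).
Proof.
move=> t0; apply/graph_continuousP => e.
have -> : (fun q => H t q q) \o chart e = heat_diag 0 e t \o clamp (len e).
  apply/funext => x /=; rewrite chart_clamp heat_kernel_diagE//.
  exact/clamp_itv/ltW/len_gt0.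
move=> x; apply: continuous_comp; first exact: clamp_continuous.
exact: heat_diag_continuous.
Qed.

Lemma heat_kernel_diag_kirchhoff t : 0 < t ->
  kirchhoff_neumann (fun q => H t q q).
Proof.
move=> t0.
(* At the target end the outward direction reverses the parametrization, whence the sign. *)
exists (fun d => if d.2 then - heat_diag 1 d.1 t (len d.1)
                 else heat_diag 1 d.1 t 0); split=> [[e b]|v].
  have l0 := len_gt0 e; case: b.
    apply: (@quad_approx_outward _ _ _ (e, true)
      (fun s => heat_diag 0 e t (len e - s))).
      move=> s /andP[s0 sl]; rewrite /end_chart/= heat_kernel_diagE//.
      by rewrite subr_ge0 gerBl s0 andbT.
    exact/quad_approx_reflect/heat_diag_quad_approx.
  apply: (@quad_approx_outward _ _ _ (e, false) (heat_diag 0 e t)).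
    by move=> s se; rewrite /end_chart/= heat_kernel_diagE.
  exact: heat_diag_quad_approx.
transitivity (- \sum_e (heat_diag 1 e t (len e) * (tgt e == v)%:R -
          heat_diag 1 e t 0 * (src e == v)%:R)); last first.
  by rewrite heat_diag_kirchhoff// oppr0.
(* The sum over edge ends is regrouped by edges; a loop at [v] keeps both of its terms. *)
rewrite -sumrN big_mkcond/=.
rewrite -(pair_bigA _ (fun e b => if end_vertex (e, b) == v then
  if b then - heat_diag 1 e t (len e) else heat_diag 1 e t 0 else 0))/=.
apply: eq_bigr => e _; rewrite big_bool/= /end_vertex/=.
by case: eqP => _; case: eqP => _; rewrite ?mulr1 ?mulr0; ring.
Qed.

End HeatDiagonal.

Theorem proposition6p1 (R : realType) (G : metric_graph R)
    (H : R -> gpoint G -> gpoint G -> R) :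
  connected [set: gpoint G] ->
  is_heat_kernel H ->
  let h := fun (t : R) (q : gpoint G) => H t q q in
  (forall e : edge G,
     let he := fun t x : R => h t (chart e x) in
     exists hx hxx hxxx hxt : R -> R -> R,
       forall t x : R, 0 < t -> 0 <= x <= len e ->
         [/\ deriv_on (len e) (he t) x (hx t x),
             deriv_on (len e) (hx t) x (hxx t x),
             deriv_on (len e) (hxx t) x (hxxx t x),
             is_derive t (1 : R) (hx ^~ x) (hxt t x) &
             hxt t x - 1 / 4 * hxxx t x = 0]) /\
  (forall t : R, 0 < t -> continuous (h t) /\ kirchhoff_neumann (h t)).
Proof.
move=> _ [lam [psi [[psi_lap psi_on _] HE]]] h.
have lam0 j : 0 <= lam j.
  by apply: laplacian_eigenvalue_ge0 (psi_lap j) _; rewrite psi_on eqxx.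
have [y Hy] :=
  choice (fun j => laplacian_edge_oscillation (lam0 j) (psi_lap j)).
have [y' Hy'] := choice Hy.
have osc j : edge_oscillation (psi j) (lam j) (y j) (y' j) := (Hy' j).1.
have kir j : edge_kirchhoff (y' j) := (Hy' j).2.
split=> [e he|t t0]; last first.
  split; first exact: heat_kernel_diag_continuous lam0 psi_on osc kir _ HE t t0.
  exact: heat_kernel_diag_kirchhoff lam0 psi_on osc kir _ HE t t0.
pose hk k := heat_diag lam y y' k e.
(* The time derivative is given as a quarter of the third space derivative, so the equation itself
   is immediate and its content lies in [heat_diag_is_derive_time]. *)
exists (hk 1), (hk 2), (hk 3), (fun t x => 1 / 4 * hk 3 t x) => t x t0 xe.
have xI : x \in `[0, len e] by rewrite in_itv.
have q k := heat_diag_quad_approx lam0 psi_on osc kir e x (k := k) ^~ t0.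
split.
- apply: quad_approx_deriv_on xI (q 0 isT) => z; rewrite in_itv/= => ze.
  exact: (heat_kernel_diagE osc HE t0 ze).
- exact: quad_approx_deriv_on xI (q 1 isT).
- exact: quad_approx_deriv_on xI (q 2 isT).
- exact: heat_diag_is_derive_time.
- by rewrite subrr.
Qed.
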